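(* Let $\mathbb{T}$ be the branching random walk smoothing transform associated with the point process $Z$ with points $\{X_i\}_{i=1}^{L}$. Assume that $\mathbb{T}$ has a fixed point $\mathcal{L}(W)$ with finite mean such that $\mathcal{L}(W)\ne\delta_a$ for every $a\ge0$. Then, for each fixed $p>1$, $\mathbb{E}W^p<\infty$ if and only if $$\mathbb{E}\Big(\sum_{i=1}^{L}X_i\Big)^{p}<\infty\quad\text{and}\quad\mathbb{E}\sum_{i=1}^{L}X_i^{p}<1.$$
   Context: $\mathcal{P}^+$ is the set of Borel probability measures on $[0,\infty)$; $\delta_x$ is the unit mass at $x$; $\mathcal{L}(X)$ is the distribution of $X$. $Z$ is a point process on $[0,\infty)$ (a random counting measure, locally finite on $(0,\infty)$). Its points $\{X_i\}_{i=1}^{L}$ form a nonincreasing collection of $L$ nonzero (hence positive) random variables, where $L$ is random with $\mathbb{P}\{L=\infty\}\in[0,1]$. Let $\chi$ be the intensity measure of $Z$, i.e. $\int f\,d\chi=\mathbb{E}\sum_{i=1}^{L}f(X_i)$ for Borel $f\ge0$, and $\chi^*(dx):=x\,\chi(dx)$. It is assumed throughout that $\chi^*\{0\}=0$ and that the associated branching random walk is supercritical, $\mathbb{E}L\in(1,\infty]$. The branching random walk (BRW) smoothing transform is $\mathbb{T}:\mathcal{P}^+\to\mathcal{P}^+\cup\{\delta_\infty\}$, $\mathcal{L}(U_1)\mapsto\mathcal{L}\big(\sum_{i=1}^{L}X_iU_i\big)$, where, given $Z$, $U_1,U_2,\ldots$ are conditionally independent and identically distributed. A fixed point of $\mathbb{T}$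 is a distribution $\mu=\mathcal{L}(W)\in\mathcal{P}^+$, $\mu\ne\delta_0$, with $\mathbb{T}\mu=\mu$. *)

(* Defs.v *)
From HB Require Import structures.
From mathcomp Require Import all_boot all_order all_algebra.
From mathcomp Require Import all_classical all_reals all_analysis.
From mathcomp Require Import measurable_realfun.

Set Implicit Arguments.
Unset Strict Implicit.
Unset Printing Implicit Defensive.

Import Order.TTheory GRing.Theory Num.Theory.
Import numFieldNormedType.Exports.

Local Open Scope classical_set_scope.
Local Open Scope ring_scope.
Local Open Scope ereal_scope.

(* Laws on [0, +oo[ are represented as laws on R carried by [0, +oo[. *)
Definition Pplus (R : realType) (mu : probability R R) : Prop :=
  mu `[0%R, +oo[%classic = 1.

Section point_process.
Context (R : realType) d (T : measurableType d) (P : probability T R).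

(* The points are listed in nonincreasing order and padded with zeros:
   pt i is X_(i+1) where i < L, and 0 where i >= L. *)
Record point_process := PointProcess {
  pt : nat -> {RV P >-> R} ;
  pt_ge0 : forall i w, (0 <= pt i w)%R ;
  pt_nonincreasing : forall i j w, (i <= j)%N -> (pt j w <= pt i w)%R ;
  (* local finiteness on the open half-line *)
  pt_locally_finite : forall (a b : R) w, (0 < a)%R ->
    \sum_(i <oo | (0 < pt i w)%R)
      (\d_(pt i w) `[a, b]%classic : \bar R) < +oo }.

Variable Z : point_process.

(* f (X_1) + ... + f (X_L), for f nonnegative *)
Definition pp_sum (f : R -> \bar R) (w : T) : \bar R :=
  \sum_(i <oo | (0 < pt Z i w)%R) f (pt Z i w).

(* Z w, as a counting measure *)
Definition pp_measure (w : T) (A : set R) : \bar R :=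
  pp_sum (fun x => \d_x A) w.

(* the number L of points *)
Definition pp_card (w : T) : \bar R := pp_measure w [set: R].

Definition intensity (A : set R) : \bar R := \int[P]_w pp_measure w A.

Let intensityE A : measurable A -> intensity A =
  mseries (fun i => mrestr (distribution P (pt Z i))
                           (measurable_itv `]0%R, +oo[)) 0 A.
Proof.
move=> mA; rewrite /intensity /pp_measure /pp_sum /mseries.
have mpA i : measurable (pt Z i @^-1` (A `&` `]0%R, +oo[%classic)).
  rewrite -[X in measurable X]setTI; apply: measurable_funPT => //.
  exact: measurableI.
transitivity (\int[P]_w \sum_(i <oo)
    (\1_(pt Z i @^-1` (A `&` `]0%R, +oo[%classic)) w)%:E).
  apply: eq_integral => w _; rewrite eseries_mkcond; apply: eq_eseriesr => i _.
  rewrite indicE diracE preimage_setI in_setI /=.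
  have -> : (w \in pt Z i @^-1` `]0%R, +oo[%classic) = (0 < pt Z i w)%R.
    by apply/idP/idP; rewrite inE /= in_itv /= andbT.
  have -> : (w \in pt Z i @^-1` A) = (pt Z i w \in A).
    by apply/idP/idP; rewrite !inE.
  by case: ifP => _; rewrite ?andbT ?andbF.
rewrite integral_nneseries//.
  by apply: eq_eseriesr => i _; rewrite integral_indic ?setIT.
by move=> i; apply/measurable_EFinP; exact: measurable_indic.
Qed.

Let intensity0 : intensity set0 = 0.
Proof. by rewrite intensityE// measure0. Qed.

Let intensity_ge0 A : 0 <= intensity A.
Proof.
by apply: integral_ge0 => w _; apply: nneseries_ge0 => i _ _.
Qed.

Let intensity_sigma_additive : semi_sigma_additive intensity.
Proof.
move=> F mF tF mUF; rewrite intensityE//.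
under eq_fun do under eq_bigr do rewrite intensityE//.
exact: measure_semi_sigma_additive.
Qed.

HB.instance Definition _ := isMeasure.Build _ _ _ intensity
  intensity0 intensity_ge0 intensity_sigma_additive.

(* chi^*(dx) = x chi(dx) *)
Definition size_biased_intensity (A : set R) : \bar R :=
  \int[intensity]_(x in A) x%:E.

(* the sigma-algebra generated by Z *)
Definition pp_sigma : set (set T) :=
  <<s \bigcup_i preimage_set_system setT (pt Z i) measurable >>.

End point_process.

(* Conditionally on the sigma-algebra G, the U_i are i.i.d. with law mu. *)
Definition iid_given (R : realType) d (T : measurableType d)
    (Q : probability T R) (G : set (set T)) (U : nat -> {RV Q >-> R})
    (mu : probability R R) : Prop :=
  forall (A : set T) (n : nat) (B : nat -> set R),
    G A -> (forall i, measurable (B i)) ->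
    Q (A `&` \bigcap_(i in `I_n) (U i @^-1` B i)) =
    Q A * \prod_(i < n) mu (B i).

(* [smoothing_transform Z mu nu] means nu = TT mu. The variables U_i live on an
   extension (T', Q) of the probability space (T, P) of Z, with projection pi;
   this always exists, and nu does not depend on it. As the series may
   diverge, nu is a law on the extended reals. *)
Definition smoothing_transform (R : realType) d (T : measurableType d)
    (P : probability T R) (Z : point_process P)
    (mu : probability R R) (nu : set (\bar R) -> \bar R) : Prop :=
  exists (d' : measure_display) (T' : measurableType d')
    (Q : probability T' R) (pi : {mfun T' >-> T}) (U : nat -> {RV Q >-> R}),
  [/\ forall A, measurable A -> Q (pi @^-1` A) = P A,
      iid_given (preimage_set_system setT pi (pp_sigma Z)) U mu,
      forall i w, (0 <= U i w)%R &
      forall B, measurable B ->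
        nu B = Q ((fun w => \sum_(i <oo | (0 < pt Z i (pi w))%R)
                              (pt Z i (pi w) * U i w)%:E) @^-1` B)].

(* equality of Borel measures on R, i.e. on the measurable sets *)
Definition eq_law (R : realType) (mu nu : set R -> \bar R) : Prop :=
  forall A, measurable A -> mu A = nu A.

Definition fixed_point (R : realType) d (T : measurableType d)
    (P : probability T R) (Z : point_process P) (mu : probability R R) : Prop :=
  [/\ Pplus mu, ~ eq_law mu (\d_(0%R : R)) &
      smoothing_transform Z mu (pushforward mu (@EFin R))].

(* Main.v *)
Require Import Defs.
From HB Require Import structures.
From mathcomp Require Import all_boot all_order all_algebra.
From mathcomp Require Import all_classical all_reals all_analysis.
From mathcomp Require Import measurable_realfun ring lra.

(** Let W be the fixed point and m its mean; m is positive and finite. Taking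
    means in W = sum X_i U_i gives E sum X_i = 1 ([pp_moment1]). A family U that
    is i.i.d. given Z is independent of Z, so that all the expectations below
    factorize ([integral_pp_mul3], [integral_pp_pair]).

    Suppose that E W^p is finite. Conditionally on Z the sum X_i U_i has mean
    m * sum X_i, and Jensen's inequality gives m^p E (sum X_i)^p <= E W^p
    ([pp_sum_pow_lty]). Superadditivity of the p-th power gives
    E sum X_i^p * E W^p <= E W^p. The inequality is strict because E L > 1: then
    the first two summands are positive together with positive probability
    ([pp_moment_lt1]).

    The converse is a bootstrap on p, with no recourse to the branching tree
    behind the transform. Put r = p - 1 and q = max (1, r), and assume that
    E W^q is finite. For s >= 0 let b(s) = E W (min (s W, 1))^r, which is finite.
    Insert W = sum X_i U_i, and in the i-th term of
      sum_i X_i U_i (min (s sum_j X_j U_j, 1))^r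
    separate X_i U_i from the other summands by
    (x + y)^r <= l x^r + C y^r ([truncated_power_sum]). The first part yields
    l E sum X_i b(s X_i), with a sharp constant: l = 1 if r <= 1, and l > 1
    can be taken arbitrarily close to 1 otherwise. In the second part U_i is independent of the other
    U_j, whose contribution is controlled by E W^q and E (sum X_i)^p. Therefore
      b(s) <= l E sum X_i b(s X_i) + D s^r    ([truncated_moment_rec]).
    Because E W^q is finite, b(s) <= e s^(q-1) + c s^r for every e > 0 and some c
    ([truncated_moment_init]). Inserted in the recursion, such a bound keeps its
    first term, as l E sum X_i^q <= 1, and its constant c becomes
    l E sum X_i^p c + D. Since l E sum X_i^p < 1, iterating and then letting e
    tend to 0 gives b(s) <= K s^r with K independent of s
    ([contracting_bound_iterate]). Finally s^(-r) b(s) increases to E W^p as s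
    decreases to 0 ([moment_le_truncated]). Induction on p concludes
    ([moment_lty]). *)

Import Order.TTheory GRing.Theory Num.Theory.
Import numFieldNormedType.Exports.

Local Open Scope classical_set_scope.
Local Open Scope ring_scope.
Local Open Scope ereal_scope.

(** * Inequalities for real powers *)

Section powR_inequalities.
Set Implicit Arguments.
Unset Strict Implicit.
Local Open Scope ring_scope.
Context {R : realType}.
Implicit Types (a b c x y s : R) (p q r : R).

Lemma ler_powRl r x y : 0 <= r -> 0 <= x -> x <= y -> x `^ r <= y `^ r.
Proof.
by move=> r0 x0 xy; apply: ge0_ler_powR => //; rewrite nnegrE// (le_trans x0).
Qed.

Lemma powRM1 p x : 1 < p -> 0 <= x -> x `^ p = x * x `^ (p - 1).
Proof. by move=> p1 x0; rewrite mulr_powRB1// (lt_trans ltr01). Qed.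

(** Young's inequality for the exponents p and p / (p - 1): the convex function
    y |-> y `^ p lies above its tangent at c. *)
Lemma powR_tangent p c y : 1 <= p -> 0 <= c -> 0 <= y ->
  p * c `^ (p - 1) * y <= y `^ p + (p - 1) * c `^ p.
Proof.
rewrite le_eqVlt => /predU1P[<-|p1] c0 y0.
  by rewrite subrr powRr0 powRr1// mul0r addr0 !mul1r.
have p0 : 0 < p by lra.
have p10 : 0 < p - 1 by lra.
have := @conjugate_powR R y (c `^ (p - 1)) p (p / (p - 1)) y0 (powR_ge0 _ _) p0.
rewrite divr_gt0// => /(_ isT); rewrite -powRrM mulrCA divff ?gt_eqF// mulr1.
have h : p^-1 + (p / (p - 1))^-1 = 1 by field; rewrite ?gt_eqF.
move=> /(_ h); rewrite invf_div -(ler_pM2l p0) => /le_trans h'.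
rewrite -mulrA [_ * y]mulrC; apply: h'.
by rewrite le_eqVlt; apply/orP; left; apply/eqP; field; rewrite gt_eqF.
Qed.

(** With t = (q - 1) / (p - 1), the concave power y |-> y `^ t lies below its
    tangent at 1; this is used at y = x `^ (p - 1). *)
Lemma powR_interpolation p q : 1 < p -> 1 <= q <= p ->
  exists2 t, 0 <= t <= 1 & (1 < q -> 0 < t) /\
    forall x, 0 <= x -> x `^ q <= (1 - t) * x + t * x `^ p.
Proof.
move=> p1 /andP[q1 qp]; exists ((q - 1) / (p - 1)).
  by rewrite divr_ge0 ?ler_pdivrMr ?mul1r ?lerD2r//=; lra.
split=> [q1'|x x0]; first by rewrite divr_gt0//; lra.
have [->|q1N] := eqVneq q 1.
  by rewrite subrr mul0r subr0 mul1r mul0r addr0 powRr1.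
set t := _ / _.
have q1' : 1 < q by rewrite lt_neqAle eq_sym q1N.
have t0 : 0 < t by rewrite divr_gt0//; lra.
have t1 : 1 <= t^-1 by rewrite invf_div ler_pdivlMr; lra.
have := @powR_tangent t^-1 1 (x `^ (q - 1)) t1 ler01 (powR_ge0 _ _).
rewrite powR1 !mulr1 -powRrM.
have -> : (q - 1) / t = p - 1 by rewrite /t; field; rewrite !gt_eqF//; lra.
rewrite -(ler_pM2l t0) mulrA divff ?gt_eqF// mul1r => h.
rewrite (powRM1 q1' x0) (powRM1 p1 x0).
apply: (le_trans (ler_wpM2l x0 h)).
by rewrite le_eqVlt; apply/orP; left; apply/eqP; field; rewrite gt_eqF.
Qed.

(** In (a + b) * (a + b) `^ (p - 1) the base of the second factor is lowered to
    a for the summand a, and to b for the summand b. *)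
Lemma powR_superadd p a b : 1 <= p -> 0 <= a -> 0 <= b ->
  a `^ p + b `^ p <= (a + b) `^ p.
Proof.
rewrite le_eqVlt => /predU1P[<-|p1] a0 b0; first by rewrite !powRr1// addr_ge0.
rewrite !(powRM1 p1) ?addr_ge0// mulrDl lerD// ler_wpM2l// ler_powRl//; lra.
Qed.

Lemma powR_superadd_strict p a b : 1 < p -> 0 < a -> 0 < b ->
  a `^ p + b `^ p < (a + b) `^ p.
Proof.
move=> p1 a0 b0; rewrite !(powRM1 p1) ?addr_ge0 ?ltW// mulrDl ltrD// ltr_pM2l//.
  by apply: gt0_ltr_powR; rewrite ?nnegrE; lra.
by apply: gt0_ltr_powR; rewrite ?nnegrE; lra.
Qed.

Lemma powR_superadd_sum p n (a : nat -> R) : 1 <= p -> (forall i, 0 <= a i) ->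
  \sum_(i < n) a i `^ p <= (\sum_(i < n) a i) `^ p.
Proof.
move=> p1 a0; elim: n => [|n ih]; first by rewrite !big_ord0 powR_ge0.
rewrite !big_ord_recr/=; apply: le_trans (powR_superadd p1 _ (a0 n));
  last first.
  exact: sumr_ge0.
by rewrite lerD2r.
Qed.

(** Superadditivity for the exponent r^-1, at a `^ r and b `^ r. *)
Lemma powR_subadd r a b : 0 <= r <= 1 -> 0 <= a -> 0 <= b ->
  (a + b) `^ r <= a `^ r + b `^ r.
Proof.
move=> /andP[r0 r1] a0 b0; have [->|r0'] := eqVneq r 0.
  by rewrite !powRr0; lra.
have rp : 0 < r by rewrite lt_neqAle eq_sym r0'.
have ri : 1 <= r^-1 by rewrite invf_ge1.
have := powR_superadd ri (powR_ge0 a r) (powR_ge0 b r).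
rewrite -!powRrM mulfV// !powRr1// => h.
have := ler_powRl r0 (addr_ge0 a0 b0) h.
by rewrite -powRrM mulVf// powRr1// addr_ge0// powR_ge0.
Qed.

(** Either b is at most a small multiple of a, or a is at most a large multiple
    of b. *)
Lemma powR_almost_subadd r l : 0 < r -> 1 < l ->
  exists2 C, 0 <= C & forall a b, 0 <= a -> 0 <= b ->
    (a + b) `^ r <= l * a `^ r + C * b `^ r.
Proof.
move=> r0 l1; (* (1 + e) `^ r = l *)
pose e := l `^ r^-1 - 1.
have e0 : 0 < e.
  have : 1 `^ r^-1 < l `^ r^-1.
    by apply: gt0_ltr_powR; rewrite ?invr_gt0// nnegrE; lra.
  by rewrite powR1 subr_gt0.
have el : (1 + e) `^ r = l.
  by rewrite /e addrC subrK -powRrM mulVf ?gt_eqF// powRr1//; lra.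
exists ((1 + e^-1) `^ r); first exact: powR_ge0.
have ei : 0 < e^-1 by rewrite invr_gt0.
move=> a b a0 b0; have [bea|eab] := leP b (e * a).
  rewrite -el -powRM//; last by lra.
  by apply: ler_wpDr; rewrite ?mulr_ge0 ?powR_ge0//; apply: ler_powRl; lra.
rewrite -powRM//; last by lra.
apply: ler_wpDl; first by rewrite mulr_ge0 ?powR_ge0//; lra.
apply: ler_powRl; [lra|lra|].
by rewrite mulrDl mul1r addrC lerD2l ler_pdivlMl// ltW.
Qed.

(** Sum the tangent inequality at the weighted mean of the u i. *)
Lemma powR_jensen_sum (I : finType) (P : pred I) q (x u : I -> R) :
  1 <= q -> (forall i, 0 <= x i) -> (forall i, 0 <= u i) ->
  (\sum_(i | P i) x i * u i) `^ q <=
  (\sum_(i | P i) x i) `^ (q - 1) * \sum_(i | P i) x i * u i `^ q.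
Proof.
move=> q1 x0 u0; set A := \sum_(i | _) _ * _; set S := \sum_(i | _) x i.
set B := \sum_(i | _) _ * _ `^ _.
have A0 : 0 <= A by apply: sumr_ge0 => i _; exact: mulr_ge0.
have S0 : 0 <= S by apply: sumr_ge0 => i _.
have B0 : 0 <= B by apply: sumr_ge0 => i _; rewrite mulr_ge0// powR_ge0.
have [SE|SN] := eqVneq S 0.
  have -> : A = 0.
    by apply: big1 => i Pi; rewrite (psumr_eq0P (fun j _ => x0 j) SE)// mul0r.
  by rewrite powR0 ?mulr_ge0 ?powR_ge0//; lra.
have Sp : 0 < S by rewrite lt_neqAle eq_sym SN.
pose c := A / S; have c0 : 0 <= c by exact: divr_ge0.
have : \sum_(i | P i) x i * (q * c `^ (q - 1) * u i) <=
       \sum_(i | P i) x i * (u i `^ q + (q - 1) * c `^ q).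
  by apply: ler_sum => i _; apply: ler_wpM2l => //; exact: powR_tangent.
under [leRHS]eq_bigr do rewrite mulrDr.
under [leLHS]eq_bigr do rewrite mulrCA.
rewrite big_split/= -mulr_sumr -mulr_suml -/A -/B -/S.
have AE : A = S * c by rewrite /c mulrCA mulrV ?mulr1// unitfE.
rewrite {1}AE => h.
have qc : c `^ q = c * c `^ (q - 1) by rewrite mulr_powRB1//; lra.
have {}h : S * c `^ q <= B.
  rewrite -(lerD2r (S * ((q - 1) * c `^ q))); apply: le_trans h.
  by rewrite qc le_eqVlt; apply/orP; left; apply/eqP; ring.
rewrite AE powRM// -[S `^ q]mulr_powRB1//; last lra.
by rewrite mulrAC [leLHS]mulrC ler_wpM2l// powR_ge0.
Qed.

End powR_inequalities.

(** * Truncated powers *)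

Section truncated_power.
Set Implicit Arguments.
Unset Strict Implicit.
Local Open Scope ring_scope.
Context {R : realType}.
Implicit Types (a b c x y s : R) (p q r : R).

(** This is s `^ r * y `^ (r + 1) up to y = s^-1 and linear from there on, so its
    expectation only requires a first moment.  Multiplying the argument by x
    amounts to multiplying the value by x and the parameter s by x: no constant
    is lost when a summand x * u is rescaled to u. *)
Definition truncated_power r s y := y * Num.min (s * y) 1 `^ r.

Lemma truncated_power_ge0 r s y : 0 <= y -> 0 <= truncated_power r s y.
Proof. by move=> y0; rewrite mulr_ge0// powR_ge0. Qed.

Lemma truncated_power_le r s y z : 0 <= r -> 0 <= s -> 0 <= y -> y <= z ->
  truncated_power r s y <= truncated_power r s z.
Proof.
move=> r0 s0 y0 yz; apply: ler_pM => //; first exact: powR_ge0.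
apply: ler_powRl => //; first by rewrite le_min ler01 mulr_ge0.
by rewrite le_min !ge_min lexx orbT andbT ler_wpM2l.
Qed.

(** Up to M the truncation is dropped.  Beyond M the minimum, being at most 1, is
    only kept to the power q - 1; what remains is the tail of a moment of order
    q, which is small for large M. *)
Lemma truncated_power_split p q s M y : 1 <= q -> q < p -> 0 <= s -> 0 <= M ->
  0 <= y ->
  truncated_power (p - 1) s y <=
  s `^ (p - 1) * M `^ p + s `^ (q - 1) * (if M < y then y `^ q else 0).
Proof.
move=> q1 qp s0 M0 y0; rewrite /truncated_power.
have m0 : 0 <= Num.min (s * y) 1 by rewrite le_min ler01 mulr_ge0.
have m1 : Num.min (s * y) 1 <= 1 by rewrite ge_min lexx orbT.
have ms : Num.min (s * y) 1 <= s * y by rewrite ge_min lexx.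
case: ifPn => [My|]; last first.
  rewrite -leNgt mulr0 addr0 => yM.
  rewrite -(mulr_powRB1 M0); last by lra.
  rewrite mulrCA ler_pM ?powR_ge0// -powRM//.
  by apply: ler_powRl => //; [lra|exact: (le_trans ms (ler_wpM2l s0 yM))].
apply: ler_wpDl; first by rewrite mulr_ge0 ?powR_ge0.
rewrite -(mulr_powRB1 y0); last by lra.
rewrite mulrCA ler_wpM2l// -powRM//.
apply: (@le_trans _ _ (Num.min (s * y) 1 `^ (q - 1))); last first.
  by apply: ler_powRl => //; lra.
have [->|mN] := eqVneq (Num.min (s * y) 1) 0.
  by rewrite powR0 ?powR_ge0//; lra.
by apply: ger_powR; [rewrite lt_neqAle eq_sym mN m0|lra].
Qed.

Lemma powR_truncated_power p K y : 1 < p -> 0 < K -> 0 <= y -> y <= K ->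
  y `^ p = K `^ (p - 1) * truncated_power (p - 1) K^-1 y.
Proof.
move=> p1 K0 y0 yK; rewrite /truncated_power min_l; last first.
  by rewrite ler_pdivrMl// mulr1.
rewrite mulrCA -powRM//; [|lra|by rewrite mulr_ge0// invr_ge0 ltW].
rewrite mulrA mulfV ?gt_eqF// mul1r mulr_powRB1//; lra.
Qed.

Lemma continuous_powR_gt0 r x : 0 < x -> {for x, continuous (fun y : R =>
  y `^ r)}.
Proof.
move=> x0; apply: differentiable_continuous; apply/derivable1_diffP.
by apply: derivable_powR; rewrite in_itv/= x0.
Qed.

Lemma truncated_power_cvg r s (f : R^nat) y : 0 < s -> 0 <= y ->
  (forall n, 0 <= f n <= y) -> f @ \oo --> y ->
  (truncated_power r s (f n)) @[n --> \oo] --> truncated_power r s y.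
Proof.
move=> s0 y0 fy cf; have [yE|yN] := eqVneq y 0.
  rewrite (_ : (fun n => _) = fun=> truncated_power r s y);
    first exact: cvg_cst.
  apply/funext => n; congr truncated_power.
  by have := fy n; rewrite yE -eq_le => /eqP.
have yp : 0 < y by rewrite lt_neqAle eq_sym yN.
apply: cvgM => //.
have mp : 0 < Num.min (s * y) 1 by rewrite lt_min ltr01 mulr_gt0.
apply: (@continuous_cvg _ _ _ _ _ (fun n =>
  Num.min (s * f n) 1) (fun z : R => z `^ r)); first exact: continuous_powR_gt0.
apply: (@continuous_cvg _ _ _ _ _ (fun n => s * f n) (fun z : R =>
  Num.min z 1)); last exact: cvgMl_tmp.
by apply: continuous_min; [exact: cvg_id|exact: cvg_cst].
Qed.

(** Each summand x i * u i is multiplied by a function of the whole sum.  The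
    hypothesis on l and C splits it into a function of that summand, with the
    constant l, and a function of the others, where the truncation is dropped.
    The latter function is reduced by Jensen's inequality to a sum over j != i
    of functions of u j: after averaging, u i and u j factorize. *)
Lemma truncated_power_sum (I : finType) (x u : I -> R) q r l C s :
  0 < r -> r <= q -> 1 <= q -> 0 <= l -> 0 <= C -> 0 <= s ->
  (forall a b, 0 <= a -> 0 <= b -> (a + b) `^ r <= l * a `^ r + C * b `^ r) ->
  (forall i, 0 <= x i) -> (forall i, 0 <= u i) ->
  truncated_power r s (\sum_i x i * u i) <=
  \sum_i l * (x i * truncated_power r (s * x i) (u i)) +
  C * s `^ r * \sum_i (x i * (\sum_j x j) `^ r * u i +
    \sum_(j | j != i) x i * x j * (\sum_j x j) `^ (r - 1) * u i * u j `^ q).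
Proof.
move=> r0 rq q1 l0 C0 s0 subadd x0 u0.
set S := \sum_j x j.
have S0 : 0 <= S by apply: sumr_ge0.
set A := \sum_i x i * u i.
rewrite [leLHS]/truncated_power {1}/A mulr_suml -/A [X in _ +
  X]mulr_sumr -big_split/=.
apply: ler_sum => i _.
pose b := \sum_(j | j != i) x j * u j.
have b0 : 0 <= b by apply: sumr_ge0 => j _; exact: mulr_ge0.
have AE : A = x i * u i + b by rewrite /A (bigD1 i).
have xu0 : 0 <= x i * u i by exact: mulr_ge0.
have h1 : Num.min (s * A) 1 `^ r <=
    l * Num.min (s * x i * u i) 1 `^ r + C * s `^ r * b `^ r.
  rewrite -[C * _ * _]mulrA -powRM//; apply: le_trans (subadd _ _ _ _).
  - apply: ler_powRl; first exact: ltW.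
      by rewrite le_min ler01 mulr_ge0 ?AE// addr_ge0.
    rewrite AE mulrDr -mulrA.
    rewrite [leRHS]addr_minl le_min !ge_min lexx/= lerDl mulr_ge0 ?orbT//.
  - by rewrite le_min ler01 andbT !mulr_ge0.
  - exact: mulr_ge0.
apply: (le_trans (ler_wpM2l xu0 h1)); rewrite mulrDr.
apply: lerD; first by rewrite /truncated_power !mulrA [x i * u i *
  l]mulrC !mulrA.
rewrite mulrCA ler_wpM2l ?mulr_ge0 ?powR_ge0//.
have [SE|SN] := eqVneq S 0.
  have xi0 : x i = 0 by apply: (psumr_eq0P (fun j _ => x0 j) SE).
  rewrite xi0 !mul0r add0r; apply: sumr_ge0 => j _.
  by rewrite !mul0r.
have Sp : 0 < S by rewrite lt_neqAle eq_sym SN.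
(* b <= S or (b / S) `^ r <= (b / S) `^ q *)
have h2 : b `^ r <= S `^ r + S `^ (r - q) * b `^ q.
  have [bS|Sb] := leP b S.
    by apply: ler_wpDr; [rewrite mulr_ge0 ?powR_ge0|apply: ler_powRl => //;
      lra].
  apply: ler_wpDl; first exact: powR_ge0.
  have bN : b != 0 by rewrite gt_eqF// (lt_trans Sp).
  rewrite (_ : b `^ r = b `^ (r - q) * b `^ q); last first.
    by rewrite -powRD ?subrK// bN implybT.
  rewrite ler_wpM2r ?powR_ge0// -(opprB q r) !powRN lef_pV2 ?posrE ?powR_gt0//.
    by apply: ler_powRl => //; [lra|exact: ltW].
  exact: lt_trans Sb.
have h3 : b `^ q <= S `^ (q - 1) * \sum_(j | j != i) x j * u j `^ q.
  apply: (le_trans (powR_jensen_sum _ q1 x0 u0)).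
  apply: ler_wpM2r; first by apply: sumr_ge0 => j _;
    rewrite mulr_ge0// powR_ge0.
  apply: ler_powRl; [lra|exact: sumr_ge0|].
  by rewrite /S [leRHS](bigD1 i)//= lerDr.
have h4 : S `^ (r - q) * (S `^ (q - 1) * \sum_(j | j != i) x j * u j `^ q) =
    S `^ (r - 1) * \sum_(j | j != i) x j * u j `^ q.
  by rewrite mulrA -powRD ?SN ?implybT//; congr (_ `^ _ * _); ring.
have {}h2 : b `^ r <= S `^ r + S `^ (r - 1) * \sum_(j | j != i) x j * u j `^ q.
  by apply: (le_trans h2); rewrite -h4 lerD2l ler_wpM2l ?powR_ge0.
apply: (le_trans (ler_wpM2l xu0 h2)); rewrite mulrDr lerD//.
  by rewrite mulrAC.
rewrite mulrA mulr_sumr; apply: ler_sum => j _.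
by rewrite le_eqVlt; apply/orP; left; apply/eqP; ring.
Qed.

End truncated_power.

(** * Iterating a contracting bound *)

Section contracting_bound.
Set Implicit Arguments.
Unset Strict Implicit.

(** The constant c of a bound is improved to l * k * c + D with l * k < 1, hence,
    by iteration, to any number above D / (1 - l * k).  The term in eta does not
    grow, as l * a <= 1, and eta is arbitrary. *)
Lemma contracting_bound_iterate (R : realType) (B :
  R -> \bar R) (u v l a k D : R) :
  (0 <= l)%R -> (0 <= k)%R -> (0 <= D)%R -> (l * a <= 1)%R -> (l * k < 1)%R ->
  (forall e : R, (0 < e)%R -> exists2 c : R, (0 <= c)%R & forall s,
    (0 <= s)%R ->
    B s <= (e * s `^ u + c * s `^ v)%:E) ->
  (forall eta c : R, (0 <= eta)%R -> (0 <= c)%R ->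
    (forall s, (0 <= s)%R -> B s <= (eta * s `^ u + c * s `^ v)%:E) ->
    forall s, (0 <= s)%R ->
      B s <= (l * (eta * s `^ u * a + c * s `^ v * k) + D * s `^ v)%:E) ->
  exists E : R, forall s, (0 <= s)%R -> B s <= (E * s `^ v)%:E.
Proof.
move=> l0 k0 D0 la lk init rec.
pose h := (l * k)%R; have h0 : (0 <= h)%R by exact: mulr_ge0.
have h1 : (0 < 1 - h)%R by rewrite subr_gt0.
pose E := (D / (1 - h))%R.
have E0 : (0 <= E)%R by rewrite divr_ge0// ltW.
have EE : (h * E + D = E)%R by rewrite /E; field; rewrite gt_eqF.
exists E => s s0; apply/lee_addgt0Pr => e e0.
have su0 : (0 <= s `^ u)%R by exact: powR_ge0.
have sv0 : (0 <= s `^ v)%R by exact: powR_ge0.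
pose eta := (e / (s `^ u + s `^ v + 1))%R.
have d0 : (0 < s `^ u + s `^ v + 1)%R by lra.
have eta0 : (0 < eta)%R by exact: divr_gt0.
have [c c0 cP] := init _ eta0.
have bn n x : (0 <= x)%R ->
    B x <= (eta * x `^ u + (h ^+ n * c + E) * x `^ v)%:E.
  elim: n x => [|n ih] x x0.
    rewrite expr0 mul1r; apply: (le_trans (cP x x0)); rewrite lee_fin lerD2l.
    by rewrite ler_wpM2r ?powR_ge0// lerDl.
  have cn0 : (0 <= h ^+ n * c + E)%R by rewrite addr_ge0// mulr_ge0// exprn_ge0.
  apply: (le_trans (rec _ _ (ltW eta0) cn0 ih x x0)); rewrite lee_fin.
  have xu0 : (0 <= eta * x `^ u)%R by rewrite mulr_ge0 ?powR_ge0// ltW.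
  have -> : (l * (eta * x `^ u * a + (h ^+ n * c + E) * x `^ v * k) +
    D * x `^ v =
      eta * x `^ u * (l * a) + (h * (h ^+ n) * c + (h * E + D)) * x `^ v)%R.
    by rewrite /h; ring.
  by rewrite EE exprS lerD2r ler_piMr.
have [n hn] : exists n, (h ^+ n * c <= eta)%R.
  have hc : (fun n => h ^+ n * c)%R @ \oo --> (0 * c)%R.
    by apply: cvgMr_tmp; apply: cvg_expr; rewrite ger0_norm// -subr_gt0.
  rewrite mul0r in hc.
  have [n _ /(_ n (leqnn n))/ltW] := cvgr_lt _ hc _ eta0.
  by exists n.
apply: (le_trans (bn n s s0)); rewrite -EFinD lee_fin.
have se : (eta * (s `^ u + s `^ v) <= e)%R.
  by rewrite /eta mulrAC ler_pdivrMr// ler_wpM2l//; lra.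
have := ler_wpM2r sv0 hn; move: se; lra.
Qed.

End contracting_bound.

(** * Integrals against product laws *)

Section product_law.
Set Implicit Arguments.
Unset Strict Implicit.
Context {R : realType} {d d1 d2 : measure_display}.
Context {T : measurableType d} {T1 : measurableType d1} {T2 :
  measurableType d2}.

(** The law of (X, V) and the product measure agree on rectangles, hence
    everywhere; then Tonelli applies. *)
Lemma integral_product_law (m : {measure set T -> \bar R})
    (m1 : {sigma_finite_measure set T1 -> \bar R})
    (m2 : {sigma_finite_measure set T2 -> \bar R})
    (X : T -> T1) (V : T -> T2) (f : T1 * T2 -> \bar R) :
  measurable_fun setT X -> measurable_fun setT V ->
  (forall A B, measurable A -> measurable B ->
    m (X @^-1` A `&` V @^-1` B) = m1 A * m2 B) ->
  measurable_fun setT f -> (forall z, 0 <= f z) ->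
  \int[m]_w f (X w, V w) = \int[m1]_x \int[m2]_y f (x, y).
Proof.
move=> mX mV XV mf f0.
pose XV_ w := (X w, V w).
have mXV : measurable_fun setT XV_ by exact/measurable_fun_pairP.
pose XVm : {mfun T >-> (T1 * T2)%type} :=
  HB.pack XV_ (isMeasurableFun.Build _ _ _ _ _ mXV).
rewrite -[RHS](fubini_tonelli1 _ mf f0).
transitivity (\int[pushforward m XVm]_z f z).
  by rewrite [RHS]ge0_integral_pushforward//.
apply: eq_measure_integral => A mA _; apply/esym.
by apply: (@product_measure_unique _ _ T1 T2 R m1 m2 (pushforward m XVm)) =>
  // B C mB mC.
Qed.

End product_law.

Section triple_product_law.
Set Implicit Arguments.
Unset Strict Implicit.
Context {R : realType} {d d1 d2 d3 : measure_display}.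
Context {T : measurableType d} {T1 : measurableType d1}
  {T2 : measurableType d2} {T3 : measurableType d3}.
Variables (m : {measure set T -> \bar R}).
Variables (m1 : probability T1 R) (m2 : probability T2 R) (m3 :
  probability T3 R).
Variables (X : {mfun T >-> T1}) (U : {mfun T >-> T2}) (V : {mfun T >-> T3}).
Hypothesis XUV : forall A B C, measurable A -> measurable B -> measurable C ->
    m (X @^-1` A `&` U @^-1` B `&` V @^-1` C) = m1 A * m2 B * m3 C.

(** For fixed C both sides are finite measures in A that agree on rectangles:
    (X, U) is independent of V as a pair. *)
Let XU_V (A : set (T1 * T2)) (C : set T3) : measurable A -> measurable C ->
  m ((fun w => (X w, U w)) @^-1` A `&` V @^-1` C) = (m1 \x m2) A * m3 C.
Proof.
move=> mA mC.
have mXU : measurable_fun setT (fun w => (X w, U w)).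
  by apply/measurable_fun_pairP; split => /=.
have mVC : measurable (V @^-1` C) by rewrite -[X in measurable X]setTI;
  exact: measurable_funP.
have mXUA : measurable ((fun w => (X w, U w)) @^-1` A).
  by rewrite -[X in measurable X]setTI; exact: mXU.
have m3C0 : (0 <= fine (m3 C))%R by exact: fine_ge0.
pose k := NngNum m3C0.
have m3CE : m3 C = k%:num%:E by rewrite /= fineK// fin_num_measure.
pose XUm : {mfun T >-> (T1 * T2)%type} :=
  HB.pack (fun w => (X w, U w)) (isMeasurableFun.Build _ _ _ _ _ mXU).
transitivity ((mscale k m1 \x m2) A).
  apply/esym.
  apply: (@product_measure_unique _ _ T1 T2 R (mscale k m1) m2
    (pushforward (mrestr m mVC) XUm)) => // B D mB mD.
  rewrite -[LHS]/(m (X @^-1` B `&` U @^-1` D `&` V @^-1` C)).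
  by transitivity (k%:num%:E * m1 B * m2 D) => //;
    rewrite XUV// m3CE muleC muleA.
rewrite /product_measure1 ge0_integral_mscale//;
  last exact: measurable_fun_xsection.
by rewrite m3CE muleC.
Qed.

Lemma integral_triple_product_law (f : T1 -> \bar R) (g : T2 -> \bar R)
    (h : T3 -> \bar R) :
  measurable_fun setT f -> measurable_fun setT g -> measurable_fun setT h ->
  (forall x, 0 <= f x) -> (forall x, 0 <= g x) -> (forall x, 0 <= h x) ->
  \int[m]_w (f (X w) * g (U w) * h (V w)) =
  \int[m1]_x f x * \int[m2]_x g x * \int[m3]_x h x.
Proof.
move=> mf mg mh f0 g0 h0.
have mfg : measurable_fun setT (fun z : T1 * T2 => f z.1 * g z.2).
  by apply: emeasurable_funM; exact: measurableT_comp.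
have mfgh : measurable_fun setT (fun z : (T1 * T2) * T3 =>
  f z.1.1 * g z.1.2 * h z.2).
  apply: emeasurable_funM; last exact: measurableT_comp.
  by apply: (@measurableT_comp _ _ _ _ _ _ (fun z => f z.1 * g z.2)).
pose m12 : subprobability (T1 * T2)%type R := product_subprobability
  (m1 : subprobability T1 R, m2 : subprobability T2 R).
have := @integral_product_law R _ _ _ T (T1 * T2)%type T3 m m12 m3
  (fun w => (X w, U w)) V (fun z => f z.1.1 * g z.1.2 * h z.2).
have mXU : measurable_fun setT (fun w => (X w, U w)).
  by apply/measurable_fun_pairP; split => /=.
have fgh0 (z : T1 * T2 * T3) : 0 <= f z.1.1 * g z.1.2 * h z.2.
  by rewrite !mule_ge0.
move=> /(_ mXU (measurable_funP V) XU_V mfgh fgh0) /= ->.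
transitivity (\int[m12]_z (f z.1 * g z.2 * \int[m3]_x h x)).
  by apply: eq_integral => z _; rewrite ge0_integralZl// mule_ge0.
rewrite ge0_integralZr//; last 2 first.
- by move=> z _; rewrite mule_ge0.
- exact: integral_ge0.
congr (_ * _); rewrite fubini_tonelli1//; last by move=> z; rewrite mule_ge0.
rewrite /fubini_F/=.
transitivity (\int[m1]_x (f x * \int[m2]_y g y)).
  by apply: eq_integral => x _; rewrite ge0_integralZl.
by rewrite ge0_integralZr//; exact: integral_ge0.
Qed.

End triple_product_law.

(** * Samples independent of a point process *)

Lemma integral_cst_probability (R : realType) d (T : measurableType d)
    (P : probability T R) (c : \bar R) : \int[P]_x (fun=> c) x = c.
Proof.
by rewrite integral_cst// -[RHS]mule1; congr (_ * _); exact: probability_setT.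
Qed.

Section iid_given_point_process.
Set Implicit Arguments.
Unset Strict Implicit.
Context {R : realType} {d d' : measure_display}.
Context {T : measurableType d} {P : probability T R}.
Context {T' : measurableType d'} {Q : probability T' R}.
Variables (Z : point_process P) (pi : {mfun T' >-> T}).
Variable U : nat -> {RV Q >-> R}.
Variable mu : probability R R.
Hypothesis piP : forall A, measurable A -> Q (pi @^-1` A) = P A.
Hypothesis U_iid : iid_given (preimage_set_system setT pi (pp_sigma Z)) U mu.

(** The probability space of Z with the sigma-algebra generated by Z: its
    measurable functions are the functionals of Z, the only ones that conditional
    independence given Z separates from the U i. *)
Definition pp_space :=
  g_sigma_algebraType (\bigcup_i preimage_set_system setT (pt Z i) measurable).

Lemma measurable_pp_sigma (A : set T) :
  measurable (A : set pp_space) -> measurable A.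
Proof.
apply: smallest_sub; first exact: sigma_algebra_measurable.
move=> _ [i _ [B mB <-]]; exact: measurable_funP.
Qed.

Lemma measurable_pt i : measurable_fun setT (pt Z i : pp_space -> R).
Proof.
move=> _ B mB; apply: sub_sigma_algebra; exists i => //; by exists B.
Qed.

Lemma measurable_pp_space d2 (T2 : measurableType d2) (f : pp_space -> T2) :
  measurable_fun setT f -> measurable_fun setT (f : T -> T2).
Proof. by move=> mf mD B mB; apply: measurable_pp_sigma; exact: mf. Qed.

Let idG : T -> pp_space := fun t => t.
Let midG : measurable_fun setT idG.
Proof. by move=> _ B mB; rewrite setTI; exact: measurable_pp_sigma. Qed.
HB.instance Definition _ := isMeasurableFun.Build _ _ _ _ idG midG.

Let piG : T' -> pp_space := pi.
Let mpiG : measurable_fun setT piG.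
Proof. by move=> _ B mB; apply: (measurable_funP pi) => //;
  exact: measurable_pp_sigma. Qed.
HB.instance Definition _ := isMeasurableFun.Build _ _ _ _ piG mpiG.

Let PG : probability pp_space R := distribution P idG.

(** The hypothesis on the U i at the sets B, C in positions i, j and the full
    space elsewhere. *)
Let piUU (i j : nat) (A : set pp_space) (B C : set R) : i != j ->
  measurable A -> measurable B -> measurable C ->
  Q (piG @^-1` A `&` U i @^-1` B `&` U j @^-1` C) = PG A * mu B * mu C.
Proof.
move=> ij mA mB mC.
pose n := (maxn i j).+1.
have lin : (i < n)%N by rewrite ltnS leq_maxl.
have ljn : (j < n)%N by rewrite ltnS leq_maxr.
pose S k : set R := if k == i then B else if k == j then C else setT.
have mS k : measurable (S k) by rewrite /S; case: ifP => // _; case: ifP.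
have GA : preimage_set_system setT pi (pp_sigma Z) (piG @^-1` A).
  by exists A => //; rewrite setTI.
have := U_iid n GA mS.
have -> : piG @^-1` A `&` \bigcap_(k in `I_n) (U k @^-1` S k) =
    piG @^-1` A `&` U i @^-1` B `&` U j @^-1` C.
  apply/seteqP; split=> w /=.
    move=> [Aw SU]; split; [split => //|].
      by have := SU i lin; rewrite /S/= eqxx.
    by have := SU j ljn; rewrite /S/= eqxx eq_sym (negbTE ij).
  move=> [[Aw Bw] Cw]; split => // k _; rewrite /S/=.
  by have [->//|_] := eqVneq k i; have [->|] := eqVneq k j.
move=> ->.
have -> : Q (piG @^-1` A) = PG A.
  by rewrite (piP (measurable_pp_sigma mA)).
rewrite -muleA; congr (_ * _).
rewrite (bigD1 (Ordinal lin))//= (bigD1 (Ordinal ljn))//=; last first.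
  by rewrite eq_sym.
rewrite big1 ?mule1; last first.
  move=> k /andP[ki kj]; rewrite /S.
  have -> : (k == i :> nat) = false by apply/negbTE.
  have -> : (k == j :> nat) = false by apply/negbTE.
  by rewrite probability_setT.
by rewrite /S !eqxx eq_sym (negbTE ij).
Qed.

Lemma integral_pp_pair i (F : pp_space * R -> \bar R) :
  measurable_fun setT F -> (forall z, 0 <= F z) ->
  \int[Q]_w F (pi w, U i w) = \int[P]_t \int[mu]_u F (t, u).
Proof.
move=> mF F0.
rewrite -[LHS]/(\int[Q]_w F (piG w, U i w)).
rewrite (@integral_product_law _ _ _ _ _ _ _ Q PG mu piG (U i) F)//; last first.
  move=> A B mA mB; have ij : i != i.+1 by rewrite neq_ltn ltnSn.
  have := piUU ij mA mB (@measurableT _ R).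
  by rewrite preimage_setT setIT probability_setT mule1.
rewrite ge0_integral_distribution//;
  first exact: measurable_fun_fubini_tonelli_F.
by move=> t; exact: integral_ge0.
Qed.

Lemma integral_pp_mul3 i j (f : pp_space -> \bar R) (g h : R -> \bar R) :
  i != j ->
  measurable_fun setT f -> measurable_fun setT g -> measurable_fun setT h ->
  (forall x, 0 <= f x) -> (forall x, 0 <= g x) -> (forall x, 0 <= h x) ->
  \int[Q]_w (f (pi w) * g (U i w) * h (U j w)) =
  \int[P]_t f t * \int[mu]_x g x * \int[mu]_x h x.
Proof.
move=> ij mf mg mh f0 g0 h0.
rewrite -[LHS]/(\int[Q]_w (f (piG w) * g (U i w) * h (U j w))).
rewrite (@integral_triple_product_law _ _ _ _ _ _ _ _ _ Q PG mu mu piG (U i)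
  (U j))//.
  by rewrite ge0_integral_distribution.
by move=> A B C; exact: piUU.
Qed.

Lemma integral_pp_mul2 i (f : pp_space -> \bar R) (g : R -> \bar R) :
  measurable_fun setT f -> measurable_fun setT g ->
  (forall x, 0 <= f x) -> (forall x, 0 <= g x) ->
  \int[Q]_w (f (pi w) * g (U i w)) = \int[P]_t f t * \int[mu]_x g x.
Proof.
move=> mf mg f0 g0; have ij : i != i.+1 by rewrite neq_ltn ltnSn.
have := @integral_pp_mul3 i i.+1 f g (cst 1) ij mf mg (measurable_cst _) f0 g0.
under eq_integral do rewrite mule1.
by move=> -> //; rewrite integral_cst_probability mule1.
Qed.

Lemma integral_pp (f : pp_space -> \bar R) :
  measurable_fun setT f -> (forall x, 0 <= f x) ->
  \int[Q]_w f (pi w) = \int[P]_t f t.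
Proof.
move=> mf f0.
have := @integral_pp_mul2 0 f (cst 1) mf (measurable_cst _) f0.
under eq_integral do rewrite mule1.
by move=> -> //; rewrite integral_cst_probability mule1.
Qed.

End iid_given_point_process.

(** * Bounds on integrals *)

Section integral_bounds.
Set Implicit Arguments.
Unset Strict Implicit.
Context {R : realType} {d : measure_display} {T : measurableType d}.
Variable mu : {measure set T -> \bar R}.

Lemma integral_le_lim (f : T -> \bar R) (g : (T -> \bar R)^nat) (B : \bar R) :
  measurable_fun setT f -> (forall x, 0 <= f x) ->
  (forall n, measurable_fun setT (g n)) -> (forall n x, 0 <= g n x) ->
  (forall x, nondecreasing_seq (g ^~ x)) ->
  (forall x, f x <= limn (g ^~ x)) ->
  (forall n, \int[mu]_x g n x <= B) ->
  \int[mu]_x f x <= B.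
Proof.
move=> mf f0 mg g0 ndg fg gB.
apply: (@le_trans _ _ (\int[mu]_x limn (g ^~ x))).
  apply: ge0_le_integral => //.
  apply: (emeasurable_fun_cvg g) => // x _.
  exact: ereal_nondecreasing_is_cvgn.
rewrite monotone_convergence//; apply: lime_le; last exact: nearW.
apply: ereal_nondecreasing_is_cvgn => m n mn.
by apply: ge0_le_integral => // x _; exact: ndg.
Qed.

Lemma integral_eq0_ae (f : T -> \bar R) :
  measurable_fun setT f -> (forall x, 0 <= f x) -> \int[mu]_x f x = 0 ->
  ae_eq mu setT f (cst 0).
Proof.
move=> mf f0 If; apply/(ae_eq_integral_abs mu measurableT mf); rewrite -[RHS]If.
by apply: eq_integral => x _; rewrite gee0_abs.
Qed.

(** Used in contrapositive form, to show that the integral of f is positive. *)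
Lemma integral_support_eq0 (f g : T -> \bar R) :
  measurable_fun setT f -> measurable_fun setT g ->
  (forall x, 0 <= f x) -> (forall x, 0 <= g x) ->
  (forall x, f x = 0 -> g x = 0) ->
  \int[mu]_x f x = 0 -> \int[mu]_x g x = 0.
Proof.
move=> mf mg f0 g0 fg If.
rewrite (@ge0_ae_eq_integral _ _ _ mu setT g (cst 0))//; first exact: integral0.
have := integral_eq0_ae mf f0 If.
by apply: filterS => x h _; apply: fg; exact: h.
Qed.

Lemma integral_sum_EFin (I : finType) (A : pred I) (f : I -> T -> R) :
  (forall i, measurable_fun setT (f i)) -> (forall i x, (0 <= f i x)%R) ->
  \int[mu]_x (\sum_(i | A i) f i x)%:E = \sum_(i | A i) \int[mu]_x (f i x)%:E.
Proof.
move=> mf f0; under eq_integral do rewrite -sumEFin.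
rewrite big_mkcond/=; under eq_integral do rewrite big_mkcond/=.
rewrite ge0_integral_sum//.
- apply: eq_bigr => i _; case: (A i) => //; exact: integral0.
- by move=> i; case: (A i); [exact/measurable_EFinP|exact: measurable_cst].
- by move=> i x _; case: (A i) => //; rewrite lee_fin.
Qed.

End integral_bounds.

Section moments.
Set Implicit Arguments.
Unset Strict Implicit.
Context {R : realType}.

(** Bounds on the p-th power of a limit are transferred from the approximants
    by inverting the power. *)
Lemma poweR_le_lim (u : (\bar R)^nat) (p : R) (B : \bar R) :
  (0 < p)%R -> (forall n, 0 <= u n) -> cvgn u ->
  (forall n, u n `^ p <= B) -> limn u `^ p <= B.
Proof.
move=> p0 u0 cu uB; have pN : p != 0%R by rewrite gt_eqF.
have pi0 : (0 <= p^-1)%R by rewrite invr_ge0 ltW.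
have B0 : 0 <= B by apply: le_trans (uB 0%N); exact: poweR_ge0.
have uI n : u n \in `[0, +oo] by rewrite in_itv/= leey u0.
have I0 (x : \bar R) : 0 <= x -> x \in `[0, +oo] by rewrite in_itv/= leey andbT.
have : limn u <= B `^ p^-1.
  apply: lime_le => //; apply: nearW => n.
  have := gt0_ler_poweR pi0 (I0 _ (poweR_ge0 _ _)) (I0 _ B0) (uB n).
  by rewrite -poweRrM mulfV// poweRe1.
have l0 : 0 <= limn u by apply: lime_ge => //; exact: nearW.
move=> /(gt0_ler_poweR (ltW p0) (I0 _ l0) (I0 _ (poweR_ge0 _ _))).
by rewrite -poweRrM mulVf// poweRe1.
Qed.

Lemma pp_sumE d (T : measurableType d) (P : probability T R)
    (Z : point_process P) (f : R -> \bar R) w : f 0%R = 0 ->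
  pp_sum Z f w = \sum_(i <oo) f (pt Z i w).
Proof.
move=> f0; rewrite /pp_sum eseries_mkcond; apply: eq_eseriesr => i _.
case: ifPn => // h; rewrite (_ : pt Z i w = 0%R) ?f0//; apply/eqP.
by rewrite eq_le pt_ge0 andbT leNgt.
Qed.

End moments.

(** * Moments of a fixed point *)

(** The absolute value makes the integrand nonnegative on the whole line, also
    off the half-line that carries the laws of interest. *)
Definition moment {R : realType} (mu : probability R R) (q : R) : \bar R :=
  \int[mu]_x (`|x| `^ q)%:E.

Definition pp_moment {R : realType} {d} {T : measurableType d}
    {P : probability T R} (Z : point_process P) (q : R) : \bar R :=
  \int[P]_w pp_sum Z (fun x => (x `^ q)%:E) w.

Section fixed_point_moments.
Set Implicit Arguments.
Unset Strict Implicit.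
Context {R : realType} {d d' : measure_display}.
Context {T : measurableType d} {P : probability T R}.
Context {T' : measurableType d'} {Q : probability T' R}.
Variables (Z : point_process P) (pi : {mfun T' >-> T}).
Variable U : nat -> {RV Q >-> R}.
Variable mu : probability R R.
Hypothesis piP : forall A, measurable A -> Q (pi @^-1` A) = P A.
Hypothesis U_iid : iid_given (preimage_set_system setT pi (pp_sigma Z)) U mu.
Hypothesis U_ge0 : forall i w, (0 <= U i w)%R.
Hypothesis muE : forall B, measurable B ->
  pushforward mu (@EFin R) B = Q ((fun w => \sum_(i <oo | (0 < pt Z i (pi w))%R)
    (pt Z i (pi w) * U i w)%:E) @^-1` B).
Hypothesis mu_ge0 : mu `[0%R, +oo[%classic = 1.
Hypothesis mu_neq0 : ~ eq_law mu (\d_(0%R : R)).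
Hypothesis mean_lty : moment mu 1 < +oo.

Local Notation X := (pt Z).
Local Notation rho := (pp_moment Z).
Local Notation pp := (pp_space Z).

Let S n (t : pp) : R := (\sum_(i < n) X i t)%R.
Let Y n (w : T') : R := (\sum_(i < n) X i (pi w) * U i w)%R.
Let Yoo (w : T') : \bar R := \sum_(i <oo) (X i (pi w) * U i w)%:E.

Let X_ge0 i t : (0 <= X i t)%R. Proof. exact: pt_ge0. Qed.
Hint Resolve X_ge0 : core.

Let XU_ge0 i w : (0 <= X i (pi w) * U i w)%R.
Proof. exact: mulr_ge0. Qed.

Let S_ge0 n t : (0 <= S n t)%R. Proof. exact: sumr_ge0. Qed.
Let Y_ge0 n w : (0 <= Y n w)%R. Proof. exact: sumr_ge0. Qed.

Let Y_EFin n w : (Y n w)%:E = \sum_(0 <= i < n) (X i (pi w) * U i w)%:E.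
Proof. by rewrite /Y -sumEFin big_mkord. Qed.

Let Y_nd w : nondecreasing_seq (fun n => Y n w).
Proof.
apply/nondecreasing_seqP => n; rewrite /Y big_ord_recr/=.
by rewrite lerDl.
Qed.

Let Y_le n w : (Y n w)%:E <= Yoo w.
Proof.
rewrite Y_EFin; apply: nneseries_lim_ge => i _ _.
by rewrite lee_fin.
Qed.

Let Yoo_ge0 w : 0 <= Yoo w.
Proof. by apply: nneseries_ge0 => i _ _; rewrite lee_fin. Qed.

Let Y_cvg w : (Y n w)%:E @[n --> \oo] --> Yoo w.
Proof.
rewrite (_ : (fun n => _) = (fun n =>
  \sum_(0 <= i < n) (X i (pi w) * U i w)%:E)).
  by apply: is_cvg_nneseries => i _ _; rewrite lee_fin.
by apply/funext => n; exact: Y_EFin.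
Qed.

Let mXpi i : measurable_fun setT (fun w => X i (pi w)).
Proof. exact: measurableT_comp. Qed.

Let mXU i : measurable_fun setT (fun w => X i (pi w) * U i w)%R.
Proof. by apply: measurable_funM => //; exact: measurable_funP. Qed.

Let mY n : measurable_fun setT (Y n).
Proof. exact: measurable_sum. Qed.

Let mYoo : measurable_fun setT Yoo.
Proof.
apply: ge0_emeasurable_sum => i.
  by move=> w _ _; rewrite lee_fin.
by move=> _; exact/measurable_EFinP.
Qed.

Let mS n : measurable_fun setT (S n).
Proof. by apply: measurable_sum => i; exact: measurable_pt. Qed.

(** The fixed-point equation: mu is the law of the series. *)
Let Yoo_law (F : \bar R -> \bar R) : measurable_fun setT F ->
  (forall y, 0 <= F y) -> \int[mu]_x F x%:E = \int[Q]_w F (Yoo w).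
Proof.
move=> mF F0.
pose YM : {mfun T' >-> \bar R} :=
  HB.pack Yoo (isMeasurableFun.Build _ _ _ _ _ mYoo).
have mE : measurable_fun setT (@EFin R) by [].
pose EM : {mfun R >-> \bar R} :=
  HB.pack (@EFin R) (isMeasurableFun.Build _ _ _ _ _ mE).
transitivity (\int[pushforward mu EM]_y F y).
  by rewrite [RHS]ge0_integral_pushforward.
transitivity (\int[pushforward Q YM]_y F y); last first.
  by rewrite ge0_integral_pushforward.
apply: eq_measure_integral => B mB _; rewrite [LHS]muE//.
have -> // : (fun w => \sum_(i <oo | (0 < X i (pi w))%R)
    (X i (pi w) * U i w)%:E) = Yoo.
apply/funext => w; rewrite /Yoo eseries_mkcond; apply: eq_eseriesr => i _.
case: ifPn => // h; rewrite (_ : X i (pi w) = 0%R) ?mul0r//; apply/eqP.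
by rewrite eq_le X_ge0 andbT leNgt.
Qed.

Let integral_XU i (f : pp -> R) (g : R -> R) :
  measurable_fun setT f -> measurable_fun setT g ->
  (forall t, (0 <= f t)%R) -> (forall x, (0 <= g x)%R) ->
  \int[Q]_w (f (pi w) * g (U i w))%:E =
    \int[P]_t (f t)%:E * \int[mu]_x (g x)%:E.
Proof.
move=> mf mg f0 g0.
rewrite -(integral_pp_mul2 piP U_iid i)//; try exact/measurable_EFinP;
  by move=> ?; rewrite lee_fin.
Qed.

Let integral_XUU i j (f : pp -> R) (g h : R -> R) : i != j ->
  measurable_fun setT f -> measurable_fun setT g -> measurable_fun setT h ->
  (forall t, (0 <= f t)%R) -> (forall x, (0 <= g x)%R) ->
  (forall x, (0 <= h x)%R) ->
  \int[Q]_w (f (pi w) * g (U i w) * h (U j w))%:E =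
  \int[P]_t (f t)%:E * \int[mu]_x (g x)%:E * \int[mu]_x (h x)%:E.
Proof.
move=> ij mf mg mh f0 g0 h0.
rewrite -(integral_pp_mul3 piP U_iid ij)//; try exact/measurable_EFinP;
  by move=> ?; rewrite lee_fin.
Qed.

Let mnormpowR q : measurable_fun setT (fun x : R => `|x| `^ q)%R.
Proof.
by apply: (measurableT_comp (measurable_powR q)); exact: normr_measurable.
Qed.

Let mXpow i q : measurable_fun setT (fun t : pp => X i t `^ q)%R.
Proof.
by apply: (measurableT_comp (measurable_powR q)); exact: measurable_pt.
Qed.

Lemma moment_ge0 q : 0 <= moment mu q.
Proof. by apply: integral_ge0 => x _; rewrite lee_fin powR_ge0. Qed.

Lemma pp_momentE q : (0 < q)%R ->
  rho q = \sum_(i <oo) \int[P]_w (X i w `^ q)%:E.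
Proof.
move=> q0; rewrite /pp_moment.
under eq_integral do rewrite (@pp_sumE _ _ _ _ Z (fun x =>
  (x `^ q)%:E)) ?powR0 ?gt_eqF//.
rewrite integral_nneseries//.
  by move=> i; apply/measurable_EFinP; apply: (measurable_pp_space (mXpow i q)).
by move=> i w _; rewrite lee_fin powR_ge0.
Qed.

Lemma pp_moment_ge0 q : (0 < q)%R -> 0 <= rho q.
Proof.
move=> q0; rewrite pp_momentE//; apply: nneseries_ge0 => i _ _.
by apply: integral_ge0 => w _; rewrite lee_fin powR_ge0.
Qed.

Lemma sum_moment_le q n : (0 < q)%R ->
  \sum_(i < n) \int[P]_w (X i w `^ q)%:E <= rho q.
Proof.
move=> q0; rewrite pp_momentE// -(big_mkord xpredT (fun i =>
  \int[P]_w (X i w `^ q)%:E)).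
apply: nneseries_lim_ge => i _ _.
by apply: integral_ge0 => w _; rewrite lee_fin powR_ge0.
Qed.

(** The summands factorize term by term; finiteness of the moment is needed to
    take it out of the series. *)
Lemma series_moment q : (0 < q)%R -> moment mu q < +oo ->
  \int[Q]_w \sum_(i <oo) ((X i (pi w) * U i w) `^ q)%:E = rho q * moment mu q.
Proof.
move=> q0 Mq; rewrite integral_nneseries//; last 2 first.
- by move=> i; apply/measurable_EFinP;
    exact: (measurableT_comp (measurable_powR q)).
- by move=> i w _; rewrite lee_fin powR_ge0.
rewrite pp_momentE// muleC -(@fineK _ (moment mu q)) ?ge0_fin_numE
  ?moment_ge0//.
rewrite -nneseriesZl; last first.
  by move=> i _; apply: integral_ge0 => w _; rewrite lee_fin powR_ge0.
apply: eq_eseriesr => i _; rewrite fineK ?ge0_fin_numE ?moment_ge0// muleC.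
rewrite -(@integral_XU i (fun t => X i t `^ q)%R (fun x => `|x| `^ q)%R)//.
  by apply: eq_integral => w _; rewrite powRM// ger0_norm.
by move=> t; exact: powR_ge0.
Qed.

Lemma Yoo_moment q : \int[Q]_w (Yoo w `^ q) = moment mu q.
Proof.
rewrite /moment.
have := @Yoo_law (fun y => `|y| `^ q).
under eq_integral do rewrite abse_EFin poweR_EFin.
move=> ->; last 2 first.
- apply: (measurableT_comp (measurable_poweR q)); exact: abse_measurable.
- by move=> y; exact: poweR_ge0.
by apply: eq_integral => w _; rewrite gee0_abs.
Qed.

(** Otherwise the law, which is carried by the nonnegative half-line, would be
    the unit mass at 0. *)
Let mu_pos : 0 < mu `]0%R, +oo[%classic.
Proof.
rewrite lt0e measure_ge0 andbT; apply/eqP => mu0; apply: mu_neq0 => A mA.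
have mu1 : mu [set 0%R] = 1.
  rewrite -mu_ge0 -(@setU1itv _ _ +oo%O 0%R false)//.
  rewrite measureU//; last by apply/seteqP; split => // x /= [->];
    rewrite in_itv/= ltxx.
  by rewrite -[LHS]adde0; congr (_ + _).
rewrite diracE; have [A0|A0] := boolP (0%R \in A).
  apply/eqP; rewrite eq_le probability_le1//= -[leLHS]mu1 le_measure ?inE//.
  by move=> x ->; exact: set_mem.
apply/eqP; rewrite eq_le measure_ge0 andbT.
have -> : 0%:R%:E = mu (~` [set 0%R]).
  by rewrite probability_setC// [X in _ - X]mu1 subee.
rewrite le_measure ?inE//; first exact: measurableC.
by move=> x Ax /= x0; move: A0; rewrite -x0 mem_set.
Qed.

Let meas_pos : measurable_fun setT (fun x : R => \1_`]0%R, +oo[%classic x : R).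
Proof. exact: measurable_indic. Qed.

Lemma moment_gt0 q : (0 < q)%R -> 0 < moment mu q.
Proof.
move=> q0; rewrite lt0e moment_ge0 andbT; apply/eqP => m0.
suff : mu `]0%R, +oo[%classic = 0 by move/eqP; rewrite gt_eqF.
rewrite -[X in mu X]setIT -integral_indic//.
apply: (integral_support_eq0 _ _ _ _ _ m0).
- exact/measurable_EFinP.
- exact/measurable_EFinP.
- by move=> x; rewrite lee_fin powR_ge0.
- by move=> x; rewrite lee_fin.
- move=> x [/eqP]; rewrite powR_eq0 normr_eq0 => /andP[/eqP -> _].
  by rewrite indicE memNset//= in_itv/= ltxx.
Qed.

(** Both sides of the fixed-point equation have the same mean, which is positive
    and finite and can be cancelled. *)
Lemma pp_moment1 : rho 1 = 1.
Proof.
have : rho 1 * moment mu 1 = moment mu 1.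
  rewrite -series_moment// -[RHS]Yoo_moment; apply: eq_integral => w _.
  by rewrite poweRe1//; apply: eq_eseriesr => i _; rewrite powRr1.
have m0 := moment_gt0 ltr01.
have mf : moment mu 1 \is a fin_num by rewrite ge0_fin_numE// ltW.
rewrite -[RHS]mul1e => h.
apply/eqP; rewrite eq_le; apply/andP; split.
  by rewrite -(@lee_pmul2r _ (moment mu 1))// h.
by rewrite -(@lee_pmul2r _ (moment mu 1))// h.
Qed.

Let m := fine (moment mu 1).
Let mE : moment mu 1 = m%:E.
Proof. by rewrite fineK// ge0_fin_numE// moment_ge0. Qed.
Let m_gt0 : (0 < m)%R.
Proof. by rewrite -lte_fin -mE moment_gt0. Qed.

Let normE : \int[mu]_x (`|x|)%:E = m%:E.
Proof. by rewrite -mE; apply: eq_integral => x _; rewrite powRr1. Qed.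

Lemma integral_Y_pow_le n q : (0 < q)%R ->
  \int[Q]_w (Y n w `^ q)%:E <= moment mu q.
Proof.
move=> q0; rewrite -Yoo_moment; apply: ge0_le_integral => //.
- by move=> w _; rewrite lee_fin powR_ge0.
- by apply/measurable_EFinP; exact: (measurableT_comp (measurable_powR q)).
- exact: (measurableT_comp (measurable_poweR q)).
- move=> w _; rewrite -poweR_EFin; apply: gt0_ler_poweR => //; first exact: ltW.
  + by rewrite in_itv/= leey lee_fin Y_ge0.
  + by rewrite in_itv/= leey Yoo_ge0.
Qed.

Let mpp (f : pp -> R) : measurable_fun setT f -> measurable_fun setT (fun w
  => f (pi w)).
Proof. by move=> mf; apply: (measurableT_comp (measurable_pp_space mf)). Qed.

(** Conditional Jensen: the tangent inequality at c is averaged over the U i,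
    whose conditional mean is m.  The cap n makes E c `^ p finite, so that it
    can be subtracted on both sides. *)
Let truncated_sum_pow_le n p : (1 < p)%R ->
  \int[P]_t ((m * Num.min (S n t) n%:R) `^ p)%:E <= moment mu p.
Proof.
move=> p1; pose c (t : pp) : R := (m * Num.min (S n t) n%:R)%R.
have p0 : (0 < p)%R by lra.
have c0 t : (0 <= c t)%R by rewrite mulr_ge0 ?(ltW m_gt0)// le_min S_ge0 ler0n.
have mc : measurable_fun setT c.
  apply: measurable_funM => //.
  by apply: (measurable_minr (mS n)).
have mcp q : measurable_fun setT (fun t => c t `^ q)%R.
  exact: (measurableT_comp (measurable_powR q)).
have mcX i : measurable_fun setT (fun t => c t `^ (p - 1) * X i t)%R.
  by apply: measurable_funM => //; exact: measurable_pt.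
have mmcX i : measurable_fun setT (fun t => m * (c t `^ (p - 1) * X i t))%R.
  exact: measurable_funM.
have mcS : measurable_fun setT (fun t => c t `^ (p - 1) * (m * S n t))%R.
  by apply: measurable_funM => //; exact: measurable_funM.
have mcY : measurable_fun setT (fun w => c (pi w) `^ (p - 1) * Y n w)%R.
  by apply: measurable_funM => //; exact: (mpp (mcp _)).
have mcpi : measurable_fun setT (fun w =>
  c (pi w) `^ p)%R by exact: (mpp (mcp _)).
have mYp : measurable_fun setT (fun w => Y n w `^ p)%R.
  exact: (measurableT_comp (measurable_powR p)).
have Ecp : \int[Q]_w (c (pi w) `^ p)%:E = \int[P]_t (c t `^ p)%:E.
  rewrite (integral_pp piP U_iid (f := fun t => (c t `^ p)%:E))//.
    exact/measurable_EFinP.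
  by move=> t; rewrite lee_fin powR_ge0.
have Ecfin : \int[P]_t (c t `^ p)%:E \is a fin_num.
  rewrite ge0_fin_numE; last by apply: integral_ge0 => t _;
    rewrite lee_fin powR_ge0.
  apply: (@le_lt_trans _ _ (\int[P]_t ((m * n%:R) `^ p)%:E)); last first.
    by rewrite integral_cst_probability ltry.
  apply: ge0_le_integral => //.
  - by move=> t _; rewrite lee_fin powR_ge0.
  - exact/measurable_EFinP/(measurable_pp_space (mcp p)).
  - move=> t _; rewrite lee_fin ler_powRl//; first exact: ltW.
    by rewrite ler_wpM2l ?(ltW m_gt0)// ge_min lexx orbT.
have EcY : \int[P]_t (c t `^ p)%:E <=
  \int[Q]_w (c (pi w) `^ (p - 1) * Y n w)%:E.
  have -> : \int[Q]_w (c (pi w) `^ (p - 1) * Y n w)%:E =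
      \int[P]_t (c t `^ (p - 1) * (m * S n t))%:E.
    transitivity (\sum_(i < n) \int[Q]_w (c (pi w) `^ (p - 1) * X i (pi w) *
      U i w)%:E).
      rewrite -integral_sum_EFin.
      - apply: eq_integral => w _; rewrite mulr_sumr.
        by under [in RHS]eq_bigr do rewrite -mulrA.
      - move=> i; apply: measurable_funM; last exact: measurable_funP.
        apply: measurable_funM => //.
        exact: (mpp (mcp _)).
      - by move=> i w; rewrite !mulr_ge0// powR_ge0.
    transitivity (\sum_(i < n) \int[P]_t (m * (c t `^ (p - 1) * X i t))%:E).
      apply: eq_bigr => i _.
      under eq_integral do rewrite -(ger0_norm (U_ge0 i _)).
      rewrite (@integral_XU i (fun t => c t `^ (p - 1) * X i t)%R (fun x =>
        `|x|)%R)//.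
      - rewrite normE muleC.
        under [RHS]eq_integral do rewrite EFinM.
        rewrite ge0_integralZl//.
        + exact/measurable_EFinP/(measurable_pp_space (mcX i)).
        + by move=> t _; rewrite lee_fin mulr_ge0// powR_ge0.
        + by rewrite lee_fin ltW.
      - by move=> t; rewrite mulr_ge0// powR_ge0.
    rewrite -integral_sum_EFin.
    - apply: eq_integral => t _; rewrite -mulr_sumr -mulr_sumr.
      by rewrite mulrCA.
    - by move=> i; exact: (measurable_pp_space (mmcX i)).
    - by move=> i t; rewrite !mulr_ge0 ?powR_ge0// ltW.
  apply: ge0_le_integral => //.
  - by move=> t _; rewrite lee_fin powR_ge0.
  - exact/measurable_EFinP/(measurable_pp_space (mcp p)).
  - exact/measurable_EFinP/(measurable_pp_space mcS).
  - move=> t _; rewrite lee_fin powRM1// mulrC ler_wpM2l ?powR_ge0//.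
    by rewrite ler_wpM2l ?(ltW m_gt0)// ge_min lexx.
have key : p%:E * \int[P]_t (c t `^ p)%:E <=
    \int[Q]_w (Y n w `^ p)%:E + (p - 1)%:E * \int[P]_t (c t `^ p)%:E.
  apply: (@le_trans _ _ (\int[Q]_w (p * c (pi w) `^ (p - 1) * Y n w)%:E)).
    under [leRHS]eq_integral do rewrite -mulrA EFinM.
    rewrite ge0_integralZl//.
    - by rewrite lee_wpmul2l// lee_fin ltW.
    - exact/measurable_EFinP.
    - by move=> w _; rewrite lee_fin mulr_ge0// powR_ge0.
    - by rewrite lee_fin ltW.
  have p10 : (0 <= p - 1)%R by lra.
  rewrite -Ecp -ge0_integralZl//; last 2 first.
  - exact/measurable_EFinP.
  - by move=> w _; rewrite lee_fin powR_ge0.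
  rewrite -ge0_integralD//; last 4 first.
  - by move=> w _; rewrite lee_fin powR_ge0.
  - exact/measurable_EFinP.
  - by move=> w _; rewrite mule_ge0// lee_fin powR_ge0.
  - by apply: measurable_funeM; exact/measurable_EFinP.
  apply: ge0_le_integral => //.
  - by move=> w _; rewrite lee_fin !mulr_ge0 ?powR_ge0// ltW.
  - apply/measurable_EFinP; under eq_fun do rewrite -mulrA.
    exact: measurable_funM.
  - apply: emeasurable_funD; first exact/measurable_EFinP.
    by apply: measurable_funeM; exact/measurable_EFinP.
  - move=> w _; rewrite -EFinM -EFinD lee_fin; apply: powR_tangent => //.
    exact: ltW.
have {}key : \int[P]_t (c t `^ p)%:E <= \int[Q]_w (Y n w `^ p)%:E.
  move: key; rewrite -(fineK Ecfin) -leeBlDr ?fin_numM// -!EFinM -EFinB.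
  by rewrite (_ : _ - _ = fine (\int[P]_t (c t `^ p)%:E))%R//; ring.
exact: (le_trans key (integral_Y_pow_le n p0)).
Qed.

Let S_EFin n t : (S n t)%:E = \sum_(0 <= i < n) (X i t)%:E.
Proof. by rewrite /S -sumEFin big_mkord. Qed.

Let S_nd t : nondecreasing_seq (fun n => S n t).
Proof.
by apply/nondecreasing_seqP => n; rewrite /S big_ord_recr/= lerDl.
Qed.

Let S_le n t : (S n t)%:E <= pp_sum Z (fun x => x%:E) t.
Proof.
rewrite pp_sumE// S_EFin; apply: nneseries_lim_ge => i _ _.
by rewrite lee_fin.
Qed.

Let Soo_ge0 t : 0 <= pp_sum Z (fun x => x%:E) t.
Proof. by rewrite pp_sumE//; apply: nneseries_ge0 => i _ _;
  rewrite lee_fin. Qed.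

Let mSoo : measurable_fun setT (pp_sum Z (fun x => x%:E) : pp -> \bar R).
Proof.
rewrite (_ : pp_sum _ _ = fun t => \sum_(i <oo) (X i t)%:E); last first.
  by apply/funext => t; rewrite pp_sumE.
apply: ge0_emeasurable_sum => i.
  by move=> w _ _; rewrite lee_fin.
by move=> _; apply/measurable_EFinP; exact: measurable_pt.
Qed.

(** The cap on the partial sums of the X_i is lifted by monotone convergence. *)
Lemma pp_sum_pow_lty p : (1 < p)%R -> moment mu p < +oo ->
  \int[P]_t (pp_sum Z (fun x => x%:E) t `^ p) < +oo.
Proof.
move=> p1 Mp; have p0 : (0 < p)%R by lra.
pose u n (t : pp) : R := Num.min (S n t) n%:R.
have u0 n t : (0 <= u n t)%R by rewrite le_min S_ge0 ler0n.
have mu_ n : measurable_fun setT (u n) by exact: (measurable_minr (mS n)).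
have mup n : measurable_fun setT (fun t => u n t `^ p)%R.
  exact: (measurableT_comp (measurable_powR p)).
have u_nd t : nondecreasing_seq (fun n => u n t).
  move=> k l kl; rewrite /u le_min !ge_min; apply/andP; split.
    by rewrite S_nd.
  by rewrite ler_nat kl orbT.
have mp0 : (0 < m `^ p)%R by exact: powR_gt0.
have uB n : \int[P]_t (u n t `^ p)%:E <= ((m `^ p)^-1)%:E * moment mu p.
  rewrite lee_pdivlMl// -ge0_integralZl//; last 3 first.
  - exact/measurable_EFinP/(measurable_pp_space (mup n)).
  - by move=> t _; rewrite lee_fin powR_ge0.
  - by rewrite lee_fin ltW.
  apply: le_trans (truncated_sum_pow_le n p1).
  rewrite le_eqVlt; apply/orP; left; apply/eqP; apply: eq_integral => t _.
  by rewrite powRM ?(ltW m_gt0)//; exact: u0.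
apply: (@le_lt_trans _ _ (((m `^ p)^-1)%:E * moment mu p)); last first.
  by rewrite lte_mul_pinfty// ?lee_fin ?invr_ge0 ?powR_ge0.
apply: (@integral_le_lim _ _ T P _ (fun n (t : T) => (u n t `^ p)%:E)) => //.
- exact: (measurableT_comp (measurable_poweR p) (measurable_pp_space mSoo)).
- by move=> t; exact: poweR_ge0.
- by move=> n; exact/measurable_EFinP/(measurable_pp_space (mup n)).
- by move=> n t; rewrite lee_fin powR_ge0.
- by move=> t k l kl; rewrite lee_fin ler_powRl ?(ltW p0)// u_nd.
- move=> t; have und' : nondecreasing_seq (fun n => (u n t)%:E).
    by move=> k l kl; rewrite lee_fin u_nd.
  have cu := ereal_nondecreasing_is_cvgn und'.
  have gnd : nondecreasing_seq (fun n => (u n t `^ p)%:E).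
    by move=> k l kl; rewrite lee_fin ler_powRl ?(ltW p0)// u_nd.
  have l0 : 0 <= limn (fun n => (u n t)%:E).
    by apply: lime_ge => //; apply: nearW => n; rewrite lee_fin.
  apply: (@le_trans _ _ (limn (fun n => (u n t)%:E) `^ p)); last first.
    apply: poweR_le_lim => //; first by move=> n; rewrite lee_fin.
    move=> n; rewrite poweR_EFin.
    rewrite (cvg_lim _ (ereal_nondecreasing_cvgn gnd))//.
    by apply: ereal_sup_ubound; exists n.
  apply: gt0_ler_poweR; rewrite ?in_itv/= ?leey ?Soo_ge0 ?l0 ?(ltW p0)//.
  rewrite pp_sumE//; apply: lime_le.
    by apply: is_cvg_nneseries => i _ _; rewrite lee_fin.
  apply: nearW => k; rewrite -S_EFin.
  (* for such an N the cap N is inactive on the k-th partial sum *)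
  have [N kN] : exists N, (maxn k (Num.truncn (S k t)).+1 <= N)%N by eexists.
  apply: (@le_trans _ _ (u N t)%:E).
    rewrite lee_fin le_min; apply/andP; split.
      by apply: S_nd; apply: leq_trans kN; rewrite leq_maxl.
    apply: (le_trans (ltW (truncnS_gt _))).
    by rewrite ler_nat; apply: leq_trans kN; rewrite leq_maxr.
  rewrite (cvg_lim _ (ereal_nondecreasing_cvgn und'))//.
  by apply: ereal_sup_ubound; exists N.
Qed.

Let pos_set i := [set t | 0 < X i t]%R.

Let mpos_set_pp i : measurable (pos_set i : set pp).
Proof.
have -> : pos_set i = setT `&` X i @^-1` `]0%R, +oo[%classic.
  by apply/seteqP; split=> t /=; rewrite in_itv/= andbT // => -[].
exact: measurable_pt.
Qed.

Let mpos_set i : measurable (pos_set i).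
Proof. exact: (measurable_pp_sigma (mpos_set_pp i)). Qed.

(** As the points are listed in nonincreasing order, at most one of them is
    positive where the second one vanishes. *)
Lemma second_point_pos : 1 < \int[P]_t pp_card Z t -> 0 < P (pos_set 1%N).
Proof.
move=> EL; rewrite lt0e measure_ge0 andbT; apply/eqP => P1.
move: EL; apply/negP; rewrite -leNgt.
have -> : \int[P]_t pp_card Z t = \sum_(i <oo) P (pos_set i).
  transitivity (\int[P]_t \sum_(i <oo) (\1_(pos_set i) t)%:E).
    apply: eq_integral => t _; rewrite /pp_card /pp_measure /pp_sum
      eseries_mkcond.
    apply: eq_eseriesr => i _; rewrite diracT indicE.
    by case: ifPn => h; [rewrite mem_set|rewrite memNset//; exact/negP].
  rewrite integral_nneseries//; last first.
    by move=> i; apply/measurable_EFinP; exact: measurable_indic.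
  by apply: eq_eseriesr => i _; rewrite integral_indic ?setIT.
rewrite nneseries_recl// eseries0 ?adde0; first exact: probability_le1.
move=> i i1 _; apply/eqP; rewrite eq_le measure_ge0 andbT -P1.
rewrite le_measure ?inE// => t; rewrite /pos_set/= => h.
exact: (lt_le_trans h (pt_nonincreasing Z t i1)).
Qed.

(** Superadditivity of the power gives E sum (X_i U_i)^p <= E W^p; the gap is
    positive where the first two summands are. *)
Lemma pp_moment_lt1 p : (1 < p)%R -> 1 < \int[P]_t pp_card Z t ->
  moment mu p < +oo -> rho p < 1.
Proof.
move=> p1 EL Mp; have p0 : (0 < p)%R by lra.
pose a i w := (X i (pi w) * U i w)%R.
have a0 i w : (0 <= a i w)%R by exact: XU_ge0.
pose gap w := ((a 0%N w + a 1%N w) `^ p - (a 0%N w `^ p + a 1%N w `^ p))%R.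
have gap0 w : (0 <= gap w)%R.
  by rewrite subr_ge0; apply: powR_superadd => //; exact: ltW.
have ma i : measurable_fun setT (a i) by exact: mXU.
have map i q : measurable_fun setT (fun w => a i w `^ q)%R.
  exact: (measurableT_comp (measurable_powR q)).
have mgap : measurable_fun setT gap.
  apply: measurable_funB; last exact: measurable_funD.
  by apply: (measurableT_comp (measurable_powR p)); exact: measurable_funD.
have le_pow w : \sum_(i <oo) (a i w `^ p)%:E + (gap w)%:E <= Yoo w `^ p.
  rewrite -leeBrDr//; apply: lime_le.
    by apply: is_cvg_nneseries => i _ _; rewrite lee_fin powR_ge0.
  apply: nearW => n; rewrite leeBrDr//.
  apply: (@le_trans _ _ ((Y n.+2 w)%:E `^ p)); last first.
    by apply: gt0_ler_poweR; rewrite ?in_itv/= ?leey ?lee_fin ?Y_ge0 ?Yoo_ge0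
      ?(ltW p0).
  rewrite sumEFin big_mkord -EFinD poweR_EFin lee_fin.
  have -> : Y n.+2 w = (a 0%N w + a 1%N w + \sum_(i < n) a i.+2 w)%R.
    by rewrite /Y !big_ord_recl/= addrA.
  apply: le_trans (powR_superadd (ltW p1) (addr_ge0 (a0 0%N w) (a0 1%N w))
    _); last first.
    exact: sumr_ge0.
  apply: (@le_trans _ _ (\sum_(i < n.+2) a i w `^ p + gap w)%R).
    by rewrite lerD2r 2!big_ord_recr/= -addrA lerDl addr_ge0// powR_ge0.
  rewrite !big_ord_recl/= /gap.
  rewrite [leLHS](_ : _ = (a 0%N w + a 1%N w) `^ p +
    \sum_(i < n) a i.+2 w `^ p)%R; last first.
    have E (x y z g : R) : (x + (y + z) + (g - (x + y)) = g + z)%R by ring.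
    exact: E.
  by rewrite lerD2l; apply: (powR_superadd_sum n (ltW p1) (fun i => a0 i.+2 w)).
have Egap : 0 < \int[Q]_w (gap w)%:E.
  rewrite lt0e integral_ge0 ?andbT; last by move=> w _; rewrite lee_fin.
  apply/eqP => gap_eq0.
  pose I : R -> R := \1_`]0%R, +oo[%classic.
  pose J : pp -> R := \1_(pos_set 1%N).
  have mJ : measurable_fun setT J by exact: measurable_indic.
  have : \int[Q]_w (J (pi w) * I (U 0%N w) * I (U 1%N w))%:E = 0.
    apply: (integral_support_eq0 _ _ _ _ _ gap_eq0).
    - exact/measurable_EFinP.
    - apply/measurable_EFinP; apply: measurable_funM.
        apply: measurable_funM; first exact: (mpp mJ).
        by apply: (@measurableT_comp _ _ _ _ _ _ I) => //;
          exact: measurable_funP.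
      by apply: (@measurableT_comp _ _ _ _ _ _ I) => //; exact: measurable_funP.
    - by move=> w; rewrite lee_fin.
    - by move=> w; rewrite lee_fin !mulr_ge0// /I /J indicE.
    - move=> w [gw]; rewrite /I /J !indicE; congr (_%:E).
      have [/set_mem X1|_] := boolP (pi w \in pos_set 1%N);
        last by rewrite !mul0r.
      have [/set_mem U0|_] := boolP (U 0%N w \in _);
        last by rewrite mulr0 mul0r.
      have [/set_mem U1|_] := boolP (U 1%N w \in _); last by rewrite mulr0.
      move: U0 U1; rewrite /= !in_itv/= !andbT => U0 U1.
      have X0 : (0 < X 0%N (pi w))%R by apply: (lt_le_trans X1);
        exact: pt_nonincreasing.
      have := powR_superadd_strict p1 (mulr_gt0 X0 U0) (mulr_gt0 X1 U1).
      by rewrite -subr_gt0 -/(gap w) gw ltxx.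
  rewrite (@integral_XUU 0%N 1%N J I I)//; try by move=> ?;
    rewrite /I /J indicE.
  rewrite !integral_indic ?setIT//.
  move/eqP; rewrite !mule_eq0.
  by rewrite !gt_eqF// second_point_pos.
have : rho p * moment mu p + \int[Q]_w (gap w)%:E <= moment mu p.
  rewrite -series_moment// -[leRHS]Yoo_moment -ge0_integralD//.
  - apply: ge0_le_integral => //.
    + move=> w _; apply: adde_ge0; last by rewrite lee_fin.
      by apply: nneseries_ge0 => i _ _; rewrite lee_fin powR_ge0.
    + apply: emeasurable_funD; last exact/measurable_EFinP.
      apply: ge0_emeasurable_sum => i; first by move=> w _ _;
        rewrite lee_fin powR_ge0.
      by move=> _; exact/measurable_EFinP/(map i p).
    + exact: (measurableT_comp (measurable_poweR p)).
    + by move=> w _; exact: le_pow.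
  - by move=> w _; apply: nneseries_ge0 => i _ _; rewrite lee_fin powR_ge0.
  - apply: ge0_emeasurable_sum => i; first by move=> w _ _;
      rewrite lee_fin powR_ge0.
    by move=> _; exact/measurable_EFinP/(map i p).
  - by move=> w _; rewrite lee_fin.
  - exact/measurable_EFinP.
move=> h; rewrite ltNge; apply/negP => rho1.
have Mf : moment mu p \is a fin_num by rewrite ge0_fin_numE// moment_ge0.
have : moment mu p + \int[Q]_w (gap w)%:E <= moment mu p.
  apply: le_trans h; rewrite leeD2r// -[leLHS]mul1e lee_wpmul2r// moment_ge0//.
by rewrite -leeBrDl// subee// leNgt Egap.
Qed.

Lemma pp_moment_interpolation p q : (1 < p)%R -> (1 <= q <= p)%R ->
  rho p < 1 -> rho q <= 1 /\ ((1 < q)%R -> rho q < 1).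
Proof.
move=> p1 qp rhop1; have [t /andP[t0 t1] [tq tP]] := powR_interpolation p1 qp.
have p0 : (0 < p)%R by lra.
have q0 : (0 < q)%R by case/andP: qp => ? _; lra.
have I0 i r : 0 <= \int[P]_w (X i w `^ r)%:E.
  by apply: integral_ge0 => w _; rewrite lee_fin powR_ge0.
have mXp i r : measurable_fun setT (fun w => (X i w `^ r)%:E).
  exact/measurable_EFinP/(measurable_pp_space (mXpow i r)).
have h : rho q <= (1 - t)%:E + t%:E * rho p.
  rewrite -[X in X + _]mule1 -pp_moment1 !pp_momentE//.
  rewrite -!nneseriesZl// -nneseriesD//; last 2 first.
  - by move=> i _ _; rewrite mule_ge0// lee_fin subr_ge0.
  - by move=> i _ _; rewrite mule_ge0.
  apply: lee_nneseries => [i _ _//|i _].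
  have t10 : (0 <= 1 - t)%R by rewrite subr_ge0.
  rewrite -!ge0_integralZl//; try by move=> w _; rewrite lee_fin powR_ge0.
  rewrite -ge0_integralD//; last 4 first.
  - by move=> w _; rewrite mule_ge0// lee_fin powR_ge0.
  - exact: measurable_funeM.
  - by move=> w _; rewrite mule_ge0// lee_fin powR_ge0.
  - exact: measurable_funeM.
  apply: ge0_le_integral => //.
  - by move=> w _; rewrite lee_fin powR_ge0.
  - by apply: emeasurable_funD; exact: measurable_funeM.
  - by move=> w _; rewrite -!EFinM -EFinD lee_fin powRr1// tP.
have rf : rho p \is a fin_num.
  by rewrite ge0_fin_numE ?pp_moment_ge0// (lt_trans rhop1) ?ltry.
move: rhop1 h; rewrite -(fineK rf) lte_fin -EFinM -EFinD => rhop1 h.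
split=> [|q1]; first by apply: (le_trans h); rewrite lee_fin; nra.
by apply: (le_lt_trans h); rewrite lte_fin; have := tq q1; nra.
Qed.

Local Notation tp := truncated_power.

Let mtp r s : measurable_fun setT (tp r s : R -> R).
Proof.
apply: measurable_funM => //; apply: (measurableT_comp (measurable_powR r)).
apply: measurable_minr => //; exact: measurable_funM.
Qed.

(** At most the mean of mu; up to the factor s `^ r it recovers the moment of order
    r + 1 as s tends to 0. *)
Definition truncated_moment r s := \int[mu]_x (tp r s `|x|)%:E.
Local Notation b := truncated_moment.

Let mnormfine : measurable_fun setT (fun y : \bar R => `|fine y|%R).
Proof.
by apply: measurableT_comp.
Qed.

Let b_Yoo r s : b r s = \int[Q]_w (tp r s `|fine (Yoo w)|)%:E.
Proof.
rewrite /b -(@Yoo_law (fun y => (tp r s `|fine y|)%:E))//.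
- apply/measurable_EFinP; apply: (measurableT_comp (mtp r s)).
  exact: mnormfine.
- by move=> y; rewrite lee_fin truncated_power_ge0.
Qed.

(** Bounds for the finite sums X_1 U_1 + ... + X_n U_n pass to the series, hence
    to mu.  Where the series diverges, fine makes the integrand vanish. *)
Lemma truncated_moment_le r s (B : \bar R) : (0 < r)%R -> (0 < s)%R ->
  (forall n, \int[Q]_w (tp r s (Y n w))%:E <= B) -> b r s <= B.
Proof.
move=> r0 s0 YB; rewrite b_Yoo.
have nd w : nondecreasing_seq (fun n => (tp r s (Y n w))%:E).
  move=> k l kl; rewrite lee_fin; apply: truncated_power_le; try exact: ltW.
    exact: Y_ge0.
  exact: Y_nd.
have tp0 n w : 0 <= (tp r s (Y n w))%:E.
  by rewrite lee_fin; apply: truncated_power_ge0; exact: Y_ge0.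
apply: (@integral_le_lim _ _ T' Q _ (fun n w => (tp r s (Y n w))%:E)) => //.
- apply/measurable_EFinP; apply: (measurableT_comp (mtp r s)).
  exact: (measurableT_comp mnormfine mYoo).
- by move=> w; rewrite lee_fin truncated_power_ge0.
- by move=> n; apply/measurable_EFinP; exact: (measurableT_comp (mtp r s)).
- move=> w; have [Yf|] := boolP (Yoo w \is a fin_num); last first.
    rewrite ge0_fin_numE// -leNgt leye_eq => /eqP ->.
    rewrite /= normr0 /truncated_power mul0r.
    apply: lime_ge; first exact: (ereal_nondecreasing_is_cvgn (nd w)).
    by apply: nearW => n; exact: tp0.
  have Y0 : (0 <= fine (Yoo w))%R by exact: fine_ge0.
  rewrite ger0_norm// le_eqVlt; apply/orP; left; apply/eqP/esym/cvg_lim => //.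
  apply: cvg_EFin; first by apply: nearW.
  apply: truncated_power_cvg => //.
    by move=> n; rewrite Y_ge0/= -lee_fin fineK.
  apply: (fine_cvg (f := fun n => (Y n w)%:E)).
  by rewrite fineK//; exact: Y_cvg.
Qed.

Let mSpow n q : measurable_fun setT (fun t => S n t `^ q)%R.
Proof. exact: (measurableT_comp (measurable_powR q) (mS n)). Qed.

Let S_pow_le n p : (0 < p)%R -> \int[P]_t (S n t `^ p)%:E <=
  \int[P]_t (pp_sum Z (fun x => x%:E) t `^ p).
Proof.
move=> p0; apply: ge0_le_integral => //.
- by move=> t _; rewrite lee_fin powR_ge0.
- exact/measurable_EFinP/(measurable_pp_space (mSpow n p)).
- exact: (measurableT_comp (measurable_poweR p) (measurable_pp_space mSoo)).
- move=> t _; rewrite -poweR_EFin; apply: gt0_ler_poweR; rewrite ?(ltW p0)//.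
  + by rewrite in_itv/= leey lee_fin S_ge0.
  + by rewrite in_itv/= leey Soo_ge0.
Qed.

Let mX i : measurable_fun setT (X i : pp -> R).
Proof. exact: measurable_pt. Qed.

(** The two parts of the remainder in [truncated_power_sum]: summing the weights
    X i and X i * X j recombines them into a p-th power of the sum of the X i. *)
Let cross_term1 n p : (1 < p)%R ->
  \int[Q]_w (\sum_(i < n) X i (pi w) * S n (pi w) `^ (p - 1) * `|U i w|)%:E <=
  \int[P]_t (pp_sum Z (fun x => x%:E) t `^ p) * m%:E.
Proof.
move=> p1; have p0 : (0 < p)%R by lra.
have mXS i : measurable_fun setT (fun t : pp => X i t * S n t `^ (p - 1))%R.
  exact: (measurable_funM (mX i) (mSpow n (p - 1))).
have XS0 i t : (0 <= X i t * S n t `^ (p - 1))%R by rewrite mulr_ge0 ?powR_ge0.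
rewrite (integral_sum_EFin _ _ (f := fun (i : 'I_n) w =>
  X i (pi w) * S n (pi w) `^ (p - 1) * `|U i w|)%R); last 2 first.
- move=> i; apply: measurable_funM; first exact: (mpp (mXS i)).
  by apply: measurableT_comp => //; exact: measurable_funP.
- by move=> i w; rewrite mulr_ge0.
under eq_bigr do rewrite (integral_XU _ (mXS _) (@normr_measurable R setT))//
  normE.
rewrite -ge0_sume_distrl; last first.
  by move=> i _; apply: integral_ge0 => t _; rewrite lee_fin.
apply: lee_wpmul2r; first by rewrite lee_fin ltW.
rewrite -integral_sum_EFin//; last by move=> i;
  exact: (measurable_pp_space (mXS i)).
apply: le_trans (S_pow_le n p0).
rewrite le_eqVlt; apply/orP; left; apply/eqP; apply: eq_integral => t _.
by rewrite -mulr_suml -/(S n t) mulr_powRB1.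
Qed.

Let cross_term2 n p q : (1 < p)%R -> moment mu q < +oo ->
  \int[Q]_w (\sum_(i < n) \sum_(j < n | j != i) X i (pi w) * X j (pi w) *
     S n (pi w) `^ (p - 1 - 1) * `|U i w| * `|U j w| `^ q)%:E <=
  \int[P]_t (pp_sum Z (fun x => x%:E) t `^ p) * (m%:E * moment mu q).
Proof.
move=> p1 Mq; have p0 : (0 < p)%R by lra.
pose f i j (t : pp) : R := (X i t * X j t * S n t `^ (p - 1 - 1))%R.
have mf i j : measurable_fun setT (f i j : pp -> R).
  apply: (measurable_funM _ (mSpow n (p - 1 - 1))).
  exact: (measurable_funM (mX i) (mX j)).
have f0 i j t : (0 <= f i j t)%R by rewrite !mulr_ge0 ?powR_ge0.
pose g i j w : R := (f i j (pi w) * `|U i w| * `|U j w| `^ q)%R.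
have mg i j : measurable_fun setT (g i j).
  apply: measurable_funM.
    apply: measurable_funM; first exact: (mpp (mf i j)).
    by apply: measurableT_comp => //; exact: measurable_funP.
  apply: (measurableT_comp (mnormpowR q)); exact: measurable_funP.
have g0 i j w : (0 <= g i j w)%R by rewrite !mulr_ge0 ?powR_ge0.
rewrite -[leLHS]/(\int[Q]_w (\sum_(i < n) \sum_(j < n | j != i) g i j w)%:E).
rewrite (integral_sum_EFin _ _ (f := fun (i : 'I_n) w =>
  \sum_(j < n | j != i) g i j w)%R); last 2 first.
- by move=> i; under eq_fun do rewrite big_mkcond/=;
    apply: measurable_sum => j; case: (j != i).
- by move=> i w; apply: sumr_ge0 => j _.
have gE (i j : 'I_n) : j != i -> \int[Q]_w (g i j w)%:E =
    \int[P]_t (f i j t)%:E * (m%:E * moment mu q).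
  move=> ij; have ij' : (i : nat) != j by rewrite eq_sym.
  rewrite (integral_XUU ij' (mf i j) (@normr_measurable R setT) (mnormpowR
    q))//.
  by rewrite normE muleA.
have fI0 i j : 0 <= \int[P]_t (f i j t)%:E by apply: integral_ge0 => t _;
  rewrite lee_fin.
under eq_bigr => i _.
  rewrite (integral_sum_EFin _ _ (f := fun (j : 'I_n) w => g i j w))//.
  under eq_bigr => j ij do rewrite (gE _ _ ij).
  rewrite -ge0_sume_distrl; last by move=> j _.
  over.
rewrite -ge0_sume_distrl; last by move=> i _; apply: sume_ge0 => j _.
apply: lee_wpmul2r; first by rewrite mule_ge0 ?moment_ge0// lee_fin ltW.
apply: (@le_trans _ _ (\sum_(i < n) \sum_(j < n) \int[P]_t (f i j t)%:E)).
  apply: lee_sum => i _; rewrite big_mkcond/=; apply: lee_sum => j _.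
  by case: ifP.
have mfT i j : measurable_fun setT (f i j : T -> R) by exact:
  (measurable_pp_space (mf i j)).
under eq_bigr => i _.
  rewrite -(@integral_sum_EFin _ _ T P 'I_n xpredT (fun j t => f i j t))//.
  over.
rewrite -(@integral_sum_EFin _ _ T P 'I_n xpredT (fun i t =>
  \sum_(j < n) f i j t)%R); last 2 first.
- by move=> i; exact: measurable_sum.
- by move=> i t; apply: sumr_ge0.
apply: le_trans (S_pow_le n p0).
rewrite le_eqVlt; apply/orP; left; apply/eqP; apply: eq_integral => t _.
congr (_%:E); rewrite /f.
under eq_bigr do rewrite -mulr_suml -mulr_sumr -/(S n t) -mulrA.
rewrite -mulr_suml -/(S n t).
have [->|SN] := eqVneq (S n t) 0%R; first by rewrite mul0r powR0// gt_eqF.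
by rewrite mulr_powRB1 ?mulr_powRB1//; lra.
Qed.

(** Conditionally on Z, the i-th term has mean X_i b(s X_i), to which the bound on
    b applies at the point s X_i. *)
Let diagonal_term n p q s eta c : (1 < p)%R -> (1 <= q)%R -> (0 <= s)%R ->
  (0 <= eta)%R -> (0 <= c)%R ->
  (forall x, (0 <= x)%R ->
    b (p - 1) x <= (eta * x `^ (q - 1) + c * x `^ (p - 1))%:E) ->
  \int[Q]_w (\sum_(i < n) X i (pi w) * tp (p - 1) (s *
    X i (pi w)) `|U i w|)%:E <=
  (eta * s `^ (q - 1))%:E * rho q + (c * s `^ (p - 1))%:E * rho p.
Proof.
move=> p1 q1 s0 eta0 c0 bP; have p0 : (0 < p)%R by lra.
have q0 : (0 < q)%R by lra.
pose F i (z : pp * R) : R := (X i z.1 * tp (p - 1) (s * X i z.1) `|z.2|)%R.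
have mX1 i : measurable_fun setT (fun z : pp * R => X i z.1).
  exact: (measurableT_comp (mX i) measurable_fst).
have mN2 : measurable_fun setT (fun z : pp * R => `|z.2|)%R.
  exact: (measurableT_comp (@normr_measurable R setT) measurable_snd).
have mF i : measurable_fun setT (F i).
  apply: (measurable_funM (mX1 i)); apply: (measurable_funM mN2).
  apply: (measurableT_comp (measurable_powR (p - 1))).
  apply: measurable_minr => //; apply: measurable_funM => //.
  exact: measurable_funM.
have F0 i z : (0 <= F i z)%R by rewrite mulr_ge0 ?truncated_power_ge0// X_ge0.
have mFE i : measurable_fun setT (fun z =>
  (F i z)%:E) by exact/measurable_EFinP.
have mI i : measurable_fun setT (fun t : pp => \int[mu]_u (F i (t, u))%:E).
  have := @measurable_fun_fubini_tonelli_F _ _ pp R R mu (fun z => (F i z)%:E).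
  by apply => // z; rewrite lee_fin.
have mFQ i : measurable_fun setT (fun w => F i (pi w, U i w)).
  apply: measurable_funM => //.
  apply: measurable_funM.
    by apply: measurableT_comp => //; exact: measurable_funP.
  apply: (measurableT_comp (measurable_powR (p - 1))).
  apply: measurable_minr => //; apply: measurable_funM.
    exact: measurable_funM.
  by apply: measurableT_comp => //; exact: measurable_funP.
have I0 i r : 0 <= \int[P]_w (X i w `^ r)%:E.
  by apply: integral_ge0 => w _; rewrite lee_fin powR_ge0.
have mXp i r : measurable_fun setT (fun w => (X i w `^ r)%:E).
  exact/measurable_EFinP/(measurable_pp_space (mXpow i r)).
have sq0 : (0 <= eta * s `^ (q - 1))%R by rewrite mulr_ge0 ?powR_ge0.
have sp0 : (0 <= c * s `^ (p - 1))%R by rewrite mulr_ge0 ?powR_ge0.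
rewrite (@integral_sum_EFin _ _ T' Q 'I_n xpredT (fun i w =>
  F i (pi w, U i w)))//.
apply: (@le_trans _ _ (\sum_(i < n) ((eta * s `^ (q - 1))%:E *
  \int[P]_w (X i w `^ q)%:E +
    (c * s `^ (p - 1))%:E * \int[P]_w (X i w `^ p)%:E))); last first.
  rewrite big_split/=; apply: leeD.
    rewrite -ge0_sume_distrr//; apply: lee_wpmul2l; first by rewrite lee_fin.
    exact: sum_moment_le.
  rewrite -ge0_sume_distrr//; apply: lee_wpmul2l; first by rewrite lee_fin.
  exact: sum_moment_le.
apply: lee_sum => i _.
rewrite (integral_pp_pair piP U_iid i (F := fun z => (F i z)%:E))//; last first.
  by move=> z; rewrite lee_fin.
have XP0 r t : (0 <= X i t `^ r)%R by exact: powR_ge0.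
rewrite -!ge0_integralZl//; try by move=> w _; rewrite lee_fin.
rewrite -ge0_integralD//; last 4 first.
- by move=> w _; rewrite mule_ge0// lee_fin.
- exact: measurable_funeM.
- by move=> w _; rewrite mule_ge0// lee_fin.
- exact: measurable_funeM.
apply: ge0_le_integral => //.
- by move=> t _; apply: integral_ge0 => u _; rewrite lee_fin.
- exact: (measurable_pp_space (mI i)).
- by apply: emeasurable_funD; exact: measurable_funeM.
- move=> t _.
  have mtpN : measurable_fun setT (fun u : R =>
    (tp (p - 1) (s * X i t) `|u|)%:E).
    by apply/measurable_EFinP; exact: (measurableT_comp (mtp _ _)).
  have -> : \int[mu]_u (F i (t, u))%:E = (X i t)%:E * b (p - 1) (s * X i t).
    rewrite /b -ge0_integralZl//; last by rewrite lee_fin.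
    by move=> u _; rewrite lee_fin truncated_power_ge0.
  apply: (@le_trans _ _ ((X i t)%:E * (eta * (s * X i t) `^ (q - 1) +
    c * (s * X i t) `^ (p - 1))%:E)).
    by apply: lee_wpmul2l; [rewrite lee_fin|apply: bP; rewrite mulr_ge0].
  rewrite -!EFinM -EFinD lee_fin !powRM// mulrDr.
  rewrite -(mulr_powRB1 (X_ge0 i t) q0) -(mulr_powRB1 (X_ge0 i t) p0).
  by rewrite le_eqVlt; apply/orP; left; apply/eqP; ring.
Qed.

Let truncated_moment0 r : (0 < r)%R -> b r 0 = 0.
Proof.
move=> r0; rewrite /b integral0_eq// => x _; rewrite /truncated_power mul0r.
by rewrite min_l// powR0 ?mulr0// gt_eqF.
Qed.

(** One use of the fixed-point equation improves a bound on b: its two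
    coefficients are multiplied by l a and l k, up to an error of the order of
    the second term. *)
Lemma truncated_moment_rec p q l C a k : (1 < p)%R -> (1 <= q)%R ->
  (p - 1 <= q)%R -> (0 <= l)%R -> (0 <= C)%R ->
  (forall x y : R, 0 <= x -> 0 <= y ->
    (x + y) `^ (p - 1) <= l * x `^ (p - 1) + C * y `^ (p - 1))%R ->
  moment mu q < +oo ->
  \int[P]_t (pp_sum Z (fun x => x%:E) t `^ p) < +oo ->
  rho q = a%:E -> rho p = k%:E ->
  exists2 D : R, (0 <= D)%R & forall eta c : R, (0 <= eta)%R -> (0 <= c)%R ->
    (forall x, (0 <= x)%R ->
      b (p - 1) x <= (eta * x `^ (q - 1) + c * x `^ (p - 1))%:E) ->
    forall s, (0 <= s)%R -> b (p - 1) s <=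
      (l * (eta * s `^ (q - 1) * a + c * s `^ (p - 1) * k) +
        D * s `^ (p - 1))%:E.
Proof.
move=> p1 q1 pq l0 C0 subadd Mq Sp rhoq rhop.
have p0 : (0 < p)%R by lra.
have q0 : (0 < q)%R by lra.
have r0 : (0 < p - 1)%R by lra.
set Spp := \int[P]_t _ in Sp *.
have Spf : Spp \is a fin_num.
  by rewrite ge0_fin_numE//; apply: integral_ge0 => t _; exact: poweR_ge0.
have Mqf : moment mu q \is a fin_num by rewrite ge0_fin_numE// moment_ge0.
have Spp0 : (0 <= fine Spp)%R.
  by apply: fine_ge0; apply: integral_ge0 => t _; exact: poweR_ge0.
have Mq0 : (0 <= fine (moment mu q))%R by apply: fine_ge0; exact: moment_ge0.
pose D := (C * (fine Spp * m + fine Spp * (m * fine (moment mu q))))%R.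
have m0 := ltW m_gt0.
have D0 : (0 <= D)%R.
  apply: (mulr_ge0 C0); apply: addr_ge0; apply: (mulr_ge0 Spp0) => //.
  exact: mulr_ge0.
have a0 : (0 <= a)%R by rewrite -lee_fin -rhoq; exact: pp_moment_ge0.
have k0 : (0 <= k)%R by rewrite -lee_fin -rhop; exact: pp_moment_ge0.
exists D; first exact: D0.
move=> eta c eta0 c0 bP s; rewrite le_eqVlt => /predU1P[<-|s0].
  rewrite truncated_moment0// lee_fin.
  by apply: addr_ge0; rewrite ?mulr_ge0 ?addr_ge0 ?powR_ge0//
    ?mulr_ge0 ?powR_ge0.
have -> : (l * (eta * s `^ (q - 1) * a + c * s `^ (p - 1) * k) +
  D * s `^ (p - 1))%:E =
    l%:E * ((eta * s `^ (q - 1))%:E * rho q + (c * s `^ (p - 1))%:E * rho p) +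
    (D * s `^ (p - 1))%:E by rewrite rhoq rhop.
apply: truncated_moment_le => // n.
pose dg w : R := (\sum_(i < n) X i (pi w) * tp (p - 1) (s *
  X i (pi w)) `|U i w|)%R.
pose c1 w : R := (\sum_(i < n) X i (pi w) * S n (pi w) `^ (p - 1) * `|U i w|)%R.
pose c2 w : R := (\sum_(i < n) \sum_(j < n | j != i) X i (pi w) * X j (pi w) *
     S n (pi w) `^ (p - 1 - 1) * `|U i w| * `|U j w| `^ q)%R.
have mNU i : measurable_fun setT (fun w => `|U i w|)%R.
  by apply: measurableT_comp => //; exact: measurable_funP.
have mSr r : measurable_fun setT (fun w =>
  S n (pi w) `^ r)%R by exact: (mpp (mSpow n r)).
have mdg : measurable_fun setT dg.
  apply: measurable_sum => i; apply: measurable_funM => //;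
    apply: measurable_funM => //.
  apply: (measurableT_comp (measurable_powR (p - 1))).
  apply: measurable_minr => //; apply: measurable_funM => //.
  exact: measurable_funM.
have mc1 : measurable_fun setT c1.
  apply: measurable_sum => i; apply: measurable_funM => //;
    exact: measurable_funM.
have mc2 : measurable_fun setT c2.
  apply: measurable_sum => i; under eq_fun do rewrite big_mkcond/=.
  apply: measurable_sum => j; case: (j != i) => //.
  apply: measurable_funM; last exact: (measurableT_comp (measurable_powR q)).
  by apply: measurable_funM => //; apply: measurable_funM => //;
    exact: measurable_funM.
have dg0 w : (0 <= dg w)%R.
  by apply: sumr_ge0 => i _; rewrite mulr_ge0// truncated_power_ge0.
have c10 w : (0 <= c1 w)%R.
  by apply: sumr_ge0 => i _; rewrite !mulr_ge0// powR_ge0.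
have c20 w : (0 <= c2 w)%R.
  by apply: sumr_ge0 => i _; apply: sumr_ge0 => j _;
    rewrite !mulr_ge0// powR_ge0.
have Cs0 : (0 <= C * s `^ (p - 1))%R by rewrite mulr_ge0// powR_ge0.
apply: (@le_trans _ _ (\int[Q]_w (l%:E * (dg w)%:E +
  (C * s `^ (p - 1))%:E * ((c1 w)%:E + (c2 w)%:E)))).
  apply: ge0_le_integral => //.
  - by move=> w _; rewrite lee_fin truncated_power_ge0// Y_ge0.
  - by apply/measurable_EFinP; exact: (measurableT_comp (mtp _ _)).
  - apply: emeasurable_funD; apply: measurable_funeM;
      first exact/measurable_EFinP.
    by apply: emeasurable_funD; exact/measurable_EFinP.
  - move=> w _; rewrite [leRHS](_ :
      _ = (l * dg w + C * s `^ (p - 1) * (c1 w + c2 w))%:E) // lee_fin.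
    have := @truncated_power_sum R 'I_n (fun i => X i (pi w)) (fun i => U i w) q
      (p - 1) l C s r0 pq q1 l0 C0 (ltW s0) subadd (fun i =>
        X_ge0 i (pi w)) (fun i => U_ge0 i w).
    move=> /le_trans; apply; rewrite le_eqVlt; apply/orP; left; apply/eqP.
    congr (_ + _)%R.
      rewrite /dg mulr_sumr; apply: eq_bigr => i _.
      by rewrite ger0_norm.
    congr (_ * _)%R; rewrite /c1 /c2 -big_split/=; apply: eq_bigr => i _.
    rewrite ger0_norm//; congr (_ + _)%R; apply: eq_bigr => j _.
    by rewrite ger0_norm.
rewrite ge0_integralD//; last 4 first.
- by move=> w _; rewrite mule_ge0// lee_fin.
- by apply: measurable_funeM; exact/measurable_EFinP.
- by move=> w _; rewrite mule_ge0 ?adde_ge0// lee_fin.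
- by apply: measurable_funeM; apply: emeasurable_funD; exact/measurable_EFinP.
apply: leeD.
  rewrite ge0_integralZl//; last 2 first.
  - exact/measurable_EFinP.
  - by move=> w _; rewrite lee_fin.
  apply: lee_wpmul2l; first by rewrite lee_fin.
  exact: (diagonal_term n p1 q1 (ltW s0) eta0 c0 bP).
rewrite ge0_integralZl//; last 2 first.
- by apply: emeasurable_funD; exact/measurable_EFinP.
- by move=> w _; rewrite adde_ge0// lee_fin.
have -> : (D * s `^ (p - 1))%:E =
  (C * s `^ (p - 1))%:E * (Spp * m%:E + Spp * (m%:E * moment mu q)).
  rewrite -(fineK Spf) -(fineK Mqf).
  transitivity (C * s `^ (p - 1) *
    (fine Spp * m + fine Spp * (m * fine (moment mu q))))%:E; last by [].
  by congr (_%:E); rewrite /D; ring.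
apply: lee_wpmul2l; first by rewrite lee_fin.
rewrite ge0_integralD//; last 4 first.
- by move=> w _; rewrite lee_fin.
- exact/measurable_EFinP.
- by move=> w _; rewrite lee_fin.
- exact/measurable_EFinP.
by apply: leeD; [exact: cross_term1|exact: cross_term2].
Qed.

(** Dominated convergence: at each point the integrand vanishes for large n. *)
Let moment_tail q e : moment mu q < +oo -> (0 < e)%R -> exists n : nat,
  \int[mu]_x (if (n%:R < `|x|)%R then `|x| `^ q else 0)%:E <= e%:E.
Proof.
move=> Mq e0.
pose f n (x : R) : R := (if (n%:R < `|x|) then `|x| `^ q else 0)%R.
have f0 n x : (0 <= f n x)%R by rewrite /f; case: ifP => // _; exact: powR_ge0.
have mf n : measurable_fun setT (f n).
  apply: measurable_fun_ifT => //.
  by apply: measurable_fun_ltr => //; exact: measurable_cst.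
have mfE n : measurable_fun setT (fun x =>
  (f n x)%:E) by exact/measurable_EFinP.
have f_cvg x : (f n x)%:E @[n --> \oo] --> 0.
  apply: cvg_near_cst; exists (Num.truncn `|x|).+1 => // n /= xn.
  rewrite /f ltNge (le_trans (ltW (truncnS_gt `|x|)))//.
  by rewrite ler_nat.
have f_le n x : `|(f n x)%:E| <= (`|x| `^ q)%:E.
  by rewrite gee0_abs ?lee_fin// /f; case: ifP => // _; exact: powR_ge0.
have ig : mu.-integrable setT (fun x => (`|x| `^ q)%:E).
  apply/integrableP; split; first exact/measurable_EFinP.
  under eq_integral do rewrite gee0_abs ?lee_fin ?powR_ge0//.
  exact: Mq.
have [_ _] := dominated_convergence measurableT mfE (measurable_cst 0)
  (aeW mu (fun x _ => f_cvg x)) ig (aeW mu (fun x n _ => f_le n x)).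
rewrite integral0 => If0; apply: contrapT => /forallNP tail.
have : e%:E <= limn (fun n => \int[mu]_x (f n x)%:E).
  apply: lime_ge; first by apply/cvg_ex; exists 0.
  by apply: nearW => n; apply/ltW; rewrite ltNge; apply/negP; exact: tail.
by rewrite (cvg_lim _ If0)// lee_fin leNgt e0.
Qed.

(** b(s) is o(s `^ (q - 1)) at 0, because the moment of order q is finite. *)
Lemma truncated_moment_init p q e : (1 <= q)%R -> (q < p)%R ->
  moment mu q < +oo -> (0 < e)%R ->
  exists2 c : R, (0 <= c)%R & forall s, (0 <= s)%R ->
    b (p - 1) s <= (e * s `^ (q - 1) + c * s `^ (p - 1))%:E.
Proof.
move=> q1 qp Mq e0.
have [n ne] := moment_tail Mq e0.
exists (n%:R `^ p)%R; first exact: powR_ge0.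
move=> s s0.
pose f (x : R) : R := (if (n%:R < `|x|) then `|x| `^ q else 0)%R.
have f0 x : (0 <= f x)%R by rewrite /f; case: ifP => // _; exact: powR_ge0.
have mf : measurable_fun setT f.
  apply: measurable_fun_ifT => //.
  by apply: measurable_fun_ltr => //; exact: measurable_cst.
have sq0 : (0 <= s `^ (q - 1))%R by exact: powR_ge0.
apply: (@le_trans _ _ (\int[mu]_x ((s `^ (p - 1) * n%:R `^ p)%:E +
  (s `^ (q - 1))%:E * (f x)%:E))).
  apply: ge0_le_integral => //.
  - by move=> x _; rewrite lee_fin truncated_power_ge0.
  - by apply/measurable_EFinP; exact: (measurableT_comp (mtp _ _)).
  - apply: emeasurable_funD; first exact: measurable_cst.
    by apply: measurable_funeM; exact/measurable_EFinP.
  - move=> x _; rewrite -EFinM -EFinD lee_fin.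
    exact: truncated_power_split.
rewrite ge0_integralD//; last 3 first.
- by move=> x _; rewrite lee_fin mulr_ge0 ?powR_ge0.
- by move=> x _; rewrite mule_ge0// lee_fin.
- by apply: measurable_funeM; exact/measurable_EFinP.
rewrite integral_cst_probability ge0_integralZl//; last 2 first.
- exact/measurable_EFinP.
- by move=> x _; rewrite lee_fin.
rewrite addeC [in leRHS]EFinD; apply: leeD; last by rewrite lee_fin mulrC.
rewrite mulrC EFinM; by apply: lee_wpmul2l.
Qed.

(** With s = K^-1, K `^ (p - 1) times the truncated power dominates the p-th
    power on the interval up to K; K then tends to infinity. *)
Lemma moment_le_truncated p E : (1 < p)%R ->
  (forall s, (0 <= s)%R -> b (p - 1) s <= (E * s `^ (p - 1))%:E) ->
  moment mu p <= E%:E.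
Proof.
move=> p1 bE; have p0 : (0 < p)%R by lra.
pose g n (x : R) : R := (if (`|x| <= n.+1%:R) then `|x| `^ p else 0)%R.
have g0 n x : (0 <= g n x)%R by rewrite /g; case: ifP => // _; exact: powR_ge0.
have mg n : measurable_fun setT (g n).
  apply: measurable_fun_ifT => //.
  by apply: measurable_fun_ler => //; exact: measurable_cst.
have g_nd x : nondecreasing_seq (fun n => (g n x)%:E).
  move=> i j ij; rewrite lee_fin /g; case: ifPn => xi.
    by rewrite (le_trans xi)// ler_nat ltnS.
  by case: ifP => // _; exact: powR_ge0.
apply: (@integral_le_lim _ _ R mu _ (fun n x => (g n x)%:E)) => //.
- exact/measurable_EFinP.
- by move=> n; exact/measurable_EFinP.
- move=> x; rewrite (cvg_lim _ (ereal_nondecreasing_cvgn (g_nd x)))//.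
  apply: ereal_sup_ubound; exists (Num.truncn `|x|) => //.
  by rewrite /g (ltW (truncnS_gt _)).
- move=> n; have K0 : (0 < n.+1%:R :> R)%R by rewrite ltr0n.
  have Ki0 : (0 <= n.+1%:R^-1 :> R)%R by rewrite invr_ge0 ltW.
  have Kp0 : (0 <= n.+1%:R `^ (p - 1) :> R)%R by exact: powR_ge0.
  apply: (@le_trans _ _ (\int[mu]_x ((n.+1%:R `^ (p - 1))%:E *
    (tp (p - 1) n.+1%:R^-1 `|x|)%:E))).
    apply: ge0_le_integral => //.
    + by move=> x _; rewrite lee_fin.
    + exact/measurable_EFinP.
    + by apply: measurable_funeM; apply/measurable_EFinP;
        exact: (measurableT_comp (mtp _ _)).
    + move=> x _; rewrite -EFinM lee_fin /g; case: ifPn => xn.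
        by rewrite (powR_truncated_power p1 K0).
      by rewrite mulr_ge0// truncated_power_ge0.
  rewrite ge0_integralZl//; last 2 first.
  + by apply/measurable_EFinP; exact: (measurableT_comp (mtp _ _)).
  + by move=> x _; rewrite lee_fin truncated_power_ge0.
  apply: (@le_trans _ _ ((n.+1%:R `^ (p - 1))%:E * (E *
    n.+1%:R^-1 `^ (p - 1))%:E)).
    by apply: lee_wpmul2l; [rewrite lee_fin|exact: bE].
  rewrite -EFinM lee_fin mulrCA -powRM ?(ltW K0)// mulfV ?gt_eqF//
    powR1 mulr1//.
Qed.

Let moment_lty_step p q l C a k : (1 < p)%R -> (1 <= q)%R -> (q < p)%R ->
  (p - 1 <= q)%R -> (0 <= l)%R -> (0 <= C)%R ->
  (forall x y : R, 0 <= x -> 0 <= y ->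
    (x + y) `^ (p - 1) <= l * x `^ (p - 1) + C * y `^ (p - 1))%R ->
  moment mu q < +oo ->
  \int[P]_t (pp_sum Z (fun x => x%:E) t `^ p) < +oo ->
  rho q = a%:E -> rho p = k%:E -> (l * a <= 1)%R -> (l * k < 1)%R ->
  moment mu p < +oo.
Proof.
move=> p1 q1 qp pq l0 C0 subadd Mq Sp rhoq rhop la lk.
have p0 : (0 < p)%R by lra.
have k0 : (0 <= k)%R by rewrite -lee_fin -rhop; exact: pp_moment_ge0.
have [D D0 rec] := truncated_moment_rec p1 q1 pq l0 C0 subadd Mq Sp rhoq rhop.
have [E bE] := contracting_bound_iterate l0 k0 D0 la lk
  (fun e => truncated_moment_init q1 qp Mq) rec.
by apply: (le_lt_trans (moment_le_truncated p1 bE)); rewrite ltry.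
Qed.

Let pp_sum_pow_interpolation p q : (0 < q)%R -> (q <= p)%R ->
  \int[P]_t (pp_sum Z (fun x => x%:E) t `^ p) < +oo ->
  \int[P]_t (pp_sum Z (fun x => x%:E) t `^ q) < +oo.
Proof.
move=> q0 qp Sp.
have mSp r : measurable_fun setT (fun t => pp_sum Z (fun x => x%:E) t `^ r).
  exact: (measurableT_comp (measurable_poweR r) (measurable_pp_space mSoo)).
apply: (@le_lt_trans _ _ (\int[P]_t (1 + pp_sum Z (fun x => x%:E) t `^ p))).
  apply: ge0_le_integral => //.
  - by move=> t _; exact: poweR_ge0.
  - by apply: emeasurable_funD => //; exact: measurable_cst.
  - move=> t _; have := Soo_ge0 t; case: (pp_sum _ _ t) => [r|_|//].
      rewrite lee_fin => r0; rewrite !poweR_EFin -EFinD lee_fin.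
      have [r1|r1] := leP r 1%R.
        apply: ler_wpDr; first exact: powR_ge0.
        by have := ler_powRl (ltW q0) r0 r1; rewrite powR1.
      by apply: ler_wpDl => //; apply: ler_powR => //; exact: ltW.
    by rewrite !poweRyr ?gt_eqF// (lt_le_trans q0).
rewrite ge0_integralD//; last first.
  by move=> t _; exact: poweR_ge0.
by rewrite integral_cst_probability lte_add_pinfty// ltry.
Qed.

(** Induction on an integer bound of p: the step from p - 1 to p bounds the
    terms of sum X_i U_i other than the i-th by their moment of order p - 1, and
    for p <= 2 the mean is enough. *)
Lemma moment_lty p : (1 < p)%R ->
  \int[P]_t (pp_sum Z (fun x => x%:E) t `^ p) < +oo -> rho p < 1 ->
  moment mu p < +oo.
Proof.
move=> p1 Sp rp; have [n pn] : exists n, (p <= n%:R)%R.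
  by exists (Num.truncn p).+1; exact/ltW/truncnS_gt.
elim: n p pn p1 Sp rp => [|n ih] p; first by move=> p0 p1 _ _; exfalso; lra.
rewrite -natr1 => pn p1 Sp rp.
have p0 : (0 < p)%R by lra.
have [k rhop] : exists k, rho p = k%:E.
  have rpf : rho p \is a fin_num.
    by rewrite ge0_fin_numE ?pp_moment_ge0// (lt_trans rp) ?ltry.
  by exists (fine (rho p)); exact: (esym (fineK rpf)).
have k0 : (0 <= k)%R by rewrite -lee_fin -rhop; exact: pp_moment_ge0.
have k1 : (k < 1)%R by rewrite -lte_fin -rhop.
have [p2|p2] := leP p 2%R.
  apply: (moment_lty_step p1 (lexx 1%R) p1 _ ler01 ler01 _ mean_lty Sp
    pp_moment1 rhop).
  - lra.
  - move=> x y x0 y0; rewrite !mul1r; apply: powR_subadd => //.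
    by apply/andP; split; lra.
  - by rewrite mul1r.
  - by rewrite mul1r.
have qp : (1 <= p - 1 <= p)%R by apply/andP; split; lra.
have [_ rq1] := pp_moment_interpolation p1 qp rp.
have {}rq1 : rho (p - 1) < 1 by apply: rq1; lra.
have q0 : (0 < p - 1)%R by lra.
have q1 : (1 < p - 1)%R by lra.
have qltp : (p - 1 < p)%R by lra.
have [a rhoq] : exists a, rho (p - 1) = a%:E.
  have rqf : rho (p - 1) \is a fin_num.
    by rewrite (ge0_fin_numE (pp_moment_ge0 q0)) (lt_trans rq1) ?ltry.
  by exists (fine (rho (p - 1))); exact: (esym (fineK rqf)).
have a0 : (0 <= a)%R by rewrite -lee_fin -rhoq; exact: pp_moment_ge0.
have a1 : (a < 1)%R by rewrite -lte_fin -rhoq; exact: rq1.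
have Mq : moment mu (p - 1) < +oo.
  apply: (ih _ _ q1 _ rq1); first by lra.
  exact: (pp_sum_pow_interpolation q0 (ltW qltp) Sp).
(* a factor l > 1 that still leaves l * a and l * k below 1 *)
pose l := (2 / (1 + Num.max a k))%R.
have ma : (a <= Num.max a k)%R by rewrite le_max lexx.
have mk : (k <= Num.max a k)%R by rewrite le_max lexx orbT.
have m1 : (Num.max a k < 1)%R by rewrite gt_max a1.
have d0 : (0 < 1 + Num.max a k)%R by lra.
have l1 : (1 < l)%R by rewrite /l ltr_pdivlMr; lra.
have la : (l * a < 1)%R by rewrite /l mulrAC ltr_pdivrMr; lra.
have lk : (l * k < 1)%R by rewrite /l mulrAC ltr_pdivrMr; lra.
have [C C0 subadd] := powR_almost_subadd q0 l1.
exact: (moment_lty_step p1 (ltW q1) qltp (lexx _) (ltW (lt_trans ltr01 l1)) C0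
  subadd Mq Sp rhoq rhop (ltW la) lk).
Qed.

End fixed_point_moments.

(** * The moment criterion *)

Theorem proposition4 (R : realType)
  (d : measure_display) (T : measurableType d) (P : probability T R)
  (Z : point_process P)
  (Zchi0 : size_biased_intensity Z [set 0%R] = 0)
  (Zsupercritical : 1 < \int[P]_w pp_card Z w)
  (d' : measure_display) (T' : measurableType d') (P' : probability T' R)
  (W : {RV P' >-> R})
  (Wfixed : fixed_point Z (distribution P' W))
  (Wmean : 'E_P'[W] < +oo)
  (Wnondeg : forall a : R, (0 <= a)%R ->
     ~ eq_law (distribution P' W) (\d_a))
  (p : R) (p_gt1 : (1 < p)%R) :
  'E_P'[fun w => (W w `^ p)%R] < +oo <->
    \int[P]_w (pp_sum Z (fun x => x%:E) w `^ p) < +oo /\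
    \int[P]_w pp_sum Z (fun x => (x `^ p)%:E) w < 1.
Proof.
have [mu_ge0 mu_neq0 [d2 [T2 [Q [pi [U [piP U_iid U_ge0 muE]]]]]]] := Wfixed.
(* W is nonnegative only almost surely; the moments of its law use |W| *)
have W0 : {ae P', forall w, (0 <= W w)%R}.
  exists (W @^-1` (~` `[0%R, +oo[%classic)); split.
  - rewrite -[X in measurable X]setTI; apply: measurable_funP => //.
    exact: measurableC.
  - rewrite -[LHS]/(distribution P' W (~` `[0%R, +oo[%classic)).
    rewrite probability_setC//.
    by rewrite [X in _ - X](mu_ge0 : distribution P' W _ = 1) subee.
  - by move=> w /=; rewrite in_itv/= andbT => /negP; rewrite -ltNge => h;
      rewrite leNgt h.
have momentE q : (0 < q)%R -> moment (distribution P' W) q = 'E_P'[fun w =>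
  (W w `^ q)%R].
  move=> q0; rewrite /moment ge0_integral_distribution//; last first.
    apply/measurable_EFinP; apply: (measurableT_comp (measurable_powR q)).
    exact: normr_measurable.
  rewrite unlock; apply: ae_eq_integral => //.
  - apply/measurable_EFinP; apply: (measurableT_comp (measurable_powR q)).
    by apply: measurableT_comp => //; exact: measurable_funP.
  - apply/measurable_EFinP; apply: (measurableT_comp (measurable_powR q)).
    exact: measurable_funP.
  - by apply: filterS W0 => w W0 _ /=; rewrite ger0_norm.
have mean_lty : moment (distribution P' W) 1 < +oo.
  rewrite momentE//; move: Wmean; rewrite !unlock => h.
  apply: le_lt_trans h; rewrite le_eqVlt; apply/orP; left; apply/eqP.
  apply: ae_eq_integral => //.
  - apply/measurable_EFinP; apply: (measurableT_comp (measurable_powR 1)).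
    exact: measurable_funP.
  - by apply/measurable_EFinP; exact: measurable_funP.
  - by apply: filterS W0 => w W0 _ /=; rewrite powRr1.
have p0 : (0 < p)%R by rewrite (lt_trans ltr01).
rewrite -momentE//; split=> [Mp|[Sp rp]].
  split; first exact: (pp_sum_pow_lty piP U_iid U_ge0 muE mu_ge0 mu_neq0
    mean_lty p_gt1 Mp).
  exact: (pp_moment_lt1 piP U_iid U_ge0 muE mu_ge0 mu_neq0 p_gt1
    Zsupercritical Mp).
exact: (moment_lty piP U_iid U_ge0 muE mu_ge0 mu_neq0 mean_lty p_gt1 Sp rp).
Qed.
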